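(* Let $\Gamma$ be a topologically mixing locally conformal expanding semigroup of $C^{1+\alpha}$ local diffeomorphisms, with fixed inducing scheme of hyperbolic type $(\mathcal M,\tau)$, and let $F_A$ be its induced skew product and $F_A^\psi$ the corresponding induced map. Then there exists an invariant ergodic probability measure $m$ for $F_A^\psi$ whose support is contained in $\mathbb W$. Furthermore, $Q_m=\int_{\mathbb W}\psi\,dm<\infty$ and the measure $m$ can be lifted to an $F_A$-invariant measure, i.e. $\mathcal L(m)$ is an $F_A$-invariant measure.
   Context: Semigroup. $M$ is a compact connected smooth Riemannian manifold with normalized Lebesgue measure $\lambda$. $\Gamma$ is the semigroup generated under composition by $\mathrm{id}$ and $C^{1+\alpha}$ local diffeomorphisms $f_1,\dots,f_k:M\to M$ ($k>1$), the generating set being minimal. A local diffeomorphism $f$ is $U$-conformal if on $U$ one has $Df(x)=\alpha(x)\,\mathrm{Isom}(x)$ with $\alpha(x)\in\mathbb R$ and $\mathrm{Isom}(x)$ a linear isometry. $\Gamma$ is locally conformal expanding: there are a finite covering of $M$ by open balls $V_1,\dots,V_k$ and constants $\sigma<1$, $r>0$ such that for each $i$, $f_i|_{B_r(V_i)}$ is a diffeomorphism onto its image, $\|Df_i(x)^{-1}\|<\sigma$ on $B_r(V_i)$ and $f_i$ is $B_r(V_i)$-conformal ($B_r(V)$ is the $r$-neighborhood); one may assume $\max_i\mathrm{diam}(V_i)<r$. $\eta<r/2$ is a Lebesgue number of $\{V_i\}$. A word $w=(i_1,\dots,i_n)$ is admissible for $x$ if $x\in V_{i_1}$ and $f_{i_j}\circ\cdots\circ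 f_{i_1}(x)\in V_{i_{j+1}}$ for $1\le j\le n-1$; $f_w^n=f_{i_n}\circ\cdots\circ f_{i_1}$; for a ball $B$ of radius $<\eta$ centred at $f_w^n(x)$, $f_w^{-n}(B)$ is its image under the inverse branch of $f_w^n$ sending $f_w^n(x)$ to $x$ (composition of inverses of $f_{i_j}|_{B_r(V_{i_j})}$). $\Gamma$ is topologically mixing: for any open $U,V$ of diameter $<\eta/2$ there are an admissible word $w$ and an open ball $B\supset V$ of radius $<\eta$ with $f_w^{-n}(B)\subset U$. Partition. A countable Markov partition is a family of closed sets $M_i$ and maps $h_i\in\Gamma$ ($i\in\mathbb N$) with $\lambda(M\setminus\bigcup M_i)=0$, $M_i=\overline{M_i^\circ}$, $M_i^\circ\cap M_j^\circ=\emptyset$ for $i\neq j$, and $h_i(M_i)\supset M_j$ whenever $M_i^\circ\cap h_i^{-1}(M_j^\circ)\ne\emptyset$. Fix one of the form used in the paper: $\mathcal B=\{B_1,\dots,B_N\}$ is a finite cover of $M$ by open balls of radius $\varepsilon\in(0,\eta/6]$; each $h_i=f_{w_i}^{|h_i|}$ for an admissible word $w_i$ of length $|h_i|$, $M_i$ is the closure of $f_{w_i}^{-|h_i|}(B_{j(i)})$ and $h_i(M_i^\circ)=B_{j(i)}\in\mathcal B$, with $\mathrm{diam}(M_i)$ less than a Lebesgue number of $\mathcal B$; and there are indices $b_1,\dots,b_N$ with $M_{b_j}\subset B_j$, $h_{b_j}(M_{b_j}^\circ)=B_{j+1}$ ($B_{N+1}=B_1$). (So it has the finite images and finite cycle properties.)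 Let $W=\bigcup M_i^\circ$, $\tau(x)=|h_i|$ for $x\in M_i^\circ$, $\tau=0$ off $W$; $t_{ij}=1$ if $M_i^\circ\cap h_i^{-1}(M_j^\circ)\neq\emptyset$ and $0$ otherwise; $\Sigma_{\mathcal A}=\{\mathbf i\in\mathbb N^{\mathbb Z}:t_{i_ji_{j+1}}=1\ \forall j\}$ with shift $\sigma_{\mathcal A}$; $C(i)=\{\mathbf i\in\Sigma_{\mathcal A}:i_0=i\}$. Skew product. Let $A=(a_{ij})_{i,j=1}^k$, $a_{ij}=1$ if $f_i(V_i)\cap V_j\ne\emptyset$ and $0$ otherwise; $\Sigma_A=\{\mathbf j\in\{1,\dots,k\}^{\mathbb Z}:a_{j_\ell j_{\ell+1}}=1\ \forall\ell\}$ with shift $\sigma_A$; $F_A:\Sigma_A\times M\to\Sigma_A\times M$, $F_A(\mathbf i,x)=(\sigma_A\mathbf i,f_{i_0}(x))$. For $\mathbf j\in\Sigma_A$, $f_{\mathbf j}^n=f_{j_{n-1}}\circ\cdots\circ f_{j_0}$. Writing $w_j=(i_j^1,\dots,i_j^{s_j})$, $s_j=|h_j|$, with $h_j=f_{i_j^{s_j}}\circ\cdots\circ f_{i_j^1}$, let $\rho:\Sigma_{\mathcal A}\to\Sigma_A$ send $(\dots,i_{-1},i_0,i_1,\dots)$ to the concatenation of the words $w_{i_n}$, $n\in\mathbb Z$, the first letter of $w_{i_0}$ being at position $0$; $\rho$ is taken to be injective. Put $\mathbb W=\bigcup_{i\in\mathbb N}\rho(C(i))\times M_i\subset\Sigma_A\times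 M$. For $(\mathbf j,x)\in\mathbb W$ let $i_0$ be the zeroth digit of $\rho^{-1}(\mathbf j)$. The inducing time is $\psi(\mathbf j,x)=\tau(x)$ if $x\in M_{i_0}^\circ$ and $0$ otherwise; the induced map is $F_A^\psi(\mathbf j,x)=(\sigma_A^{\tau(x)}(\mathbf j),f_{\mathbf j}^{\tau(x)}(x))$ if $x\in M_{i_0}^\circ$ and $F_A^\psi(\mathbf j,x)=(\mathbf j,x)$ otherwise. A measure $m$ supported in $\mathbb W$ is extended by $0$ to $\Sigma_A\times M$, and is invariant for $F_A^\psi$ if $m((F_A^\psi)^{-1}(E))=m(E)$ for all Borel $E$. Let $\mathbb Y=\{F_A^k(\mathbf i,x):(\mathbf i,x)\in\mathbb W,\ 0\le k\le\psi(\mathbf i,x)-1\}$. If $Q_m:=\int_{\mathbb W}\psi\,dm<\infty$, the lifted measure is, for $E\subset\mathbb Y$, $$\mathcal L(m)(E)=\frac1{Q_m}\sum_{i\in\mathbb N}\sum_{k=0}^{|h_i|-1}m\big(F_A^{-k}(E)\cap(\rho(C(i))\times M_i)\big).$$ *)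

(* Defs.v *)
From HB Require Import structures.
From mathcomp Require Import all_boot all_order all_algebra.
From mathcomp Require Import all_classical all_reals all_analysis.

Set Implicit Arguments.
Unset Strict Implicit.
Unset Printing Implicit Defensive.

Import Order.TTheory GRing.Theory Num.Theory.
Import numFieldNormedType.Exports.

Local Open Scope classical_set_scope.
Local Open Scope ring_scope.

Section Smoothness.
Context {R : realType} {V W : normedModType R}.

(* In finite dimension, for D open, this is the usual class C^k on D. *)
Fixpoint Ck (k : nat) (D : set V) (f : V -> W) : Prop :=
  match k with
  | 0 => forall x, D x -> {for x, continuous f}
  | k'.+1 => (forall x, D x -> differentiable f x) /\
             (forall v, Ck k' D (fun x => 'D_v f x))
  end.

Definition Csmooth (D : set V) (f : V -> W) : Prop := forall k, Ck k D f.

End Smoothness.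

(* Integral of a nonnegative Borel function against n-dimensional Lebesgue
   measure, as an iterated one-dimensional Lebesgue integral (Tonelli). *)
Fixpoint lebesgue_integral_rV {R : realType} (n : nat) :
    ('rV[R]_n -> \bar R) -> \bar R :=
  match n with
  | 0 => fun f => f 0
  | n'.+1 => fun f =>
      (\int[@lebesgue_measure R]_t
         lebesgue_integral_rV
           (fun v : 'rV[R]_n' => f (row_mx (t%:M : 'rV[R]_1) v)))%E
  end.

(* An atlas of dimension [n] presented with one chart
   [chart p : dom p -> 'rV_n] (inverse [param p]) around each point [p].
   The functions are total, with irrelevant values off [dom p] and
   [chart p @` dom p].  The tangent space at [p] is ['rV_n], read in the chart
   at [p], and [gram p] is there the Gram matrix of the Riemannian metric. *)
Record riemannian (R : realType) (n : nat) (M : pseudoPMetricType R) :=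
  Riemannian {
  dom : M -> set M;
  chart : M -> M -> 'rV[R]_n;
  param : M -> 'rV[R]_n -> M;
  gram : M -> 'M[R]_n;
  dom_open : forall p, open (dom p);
  dom_center : forall p, dom p p;
  chart_open : forall p, open (chart p @` dom p);
  chartK : forall p x, dom p x -> param p (chart p x) = x;
  chart_continuous : forall p x, dom p x -> {for x, continuous (chart p)};
  param_continuous : forall p y, (chart p @` dom p) y ->
    {for y, continuous (param p)};
  transition_smooth : forall p q,
    Csmooth (chart p @` (dom p `&` dom q)) (chart q \o param p);
  gram_sym : forall p, (gram p)^T = gram p;
  gram_pos : forall p (u : 'rV[R]_n), u != 0 ->
    0 < (u *m gram p *m u^T) 0 0;
  (* smoothness of the metric, written in the coordinates of the chart at p *)
  gram_smooth : forall p, Csmooth (chart p @` dom p)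
    (fun y => let q := param p y in
              let J := 'J (chart q \o param p) y in
              J *m gram q *m J^T)
}.

Section Riemannian_geometry.
Context {R : realType} {n : nat} {M : pseudoPMetricType R}.
Variable g : riemannian n M.

Definition tnorm (x : M) (u : 'rV[R]_n) : R :=
  Num.sqrt ((u *m gram g x *m u^T) 0 0).

Definition local_gram (p : M) (y : 'rV[R]_n) : 'M[R]_n :=
  let q := param g p y in
  let J := 'J (chart g q \o param g p) y in
  J *m gram g q *m J^T.

Definition C1_curve (c : R -> M) : Prop :=
  continuous c /\
  forall p t, dom g p (c t) ->
    derivable (chart g p \o c) t 1 /\
    {for t, continuous (derive1 (chart g p \o c))}.

Definition speed (c : R -> M) (t : R) : R :=
  tnorm (c t) (derive1 (chart g (c t) \o c) t).

Definition curve_length (c : R -> M) : R :=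
  Rintegral (@lebesgue_measure R) `[0, 1] (speed c).

(* [piecewise_C1 x y l]: a piecewise C^1 path of length l joins x to y; each
   C^1 piece is parametrized by [0, 1] and extended to a C^1 curve on R. *)
Inductive piecewise_C1 : M -> M -> R -> Prop :=
  | piecewise_nil x : piecewise_C1 x x 0
  | piecewise_cons c y l : C1_curve c -> piecewise_C1 (c 1) y l ->
      piecewise_C1 (c 0) y (curve_length c + l).

Definition rdist (x y : M) : R := inf [set l | piecewise_C1 x y l].

Definition diam (A : set M) : R :=
  sup [set d | exists x y, [/\ A x, A y & d = rdist x y]].

(* The third clause says that the (pseudo)metric carried by the type M is the
   Riemannian distance. *)
Definition compact_connected_riemannian : Prop :=
  [/\ hausdorff_space M,
      compact [set: M] /\ connected [set: M] &
      forall x e, 0 < e -> ball x e = [set y | rdist x y < e]].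

Definition borel (T : ptopologicalType) := g_sigma_algebraType (@open T).

(* The volume has density sqrt(det g_ij) in each chart. *)
Definition normalized_volume (lambda : probability (borel M) R) : Prop :=
  exists2 c : R, 0 < c & forall p (E : set (borel M)),
    measurable E -> E `<=` dom g p ->
    lambda E = (c%:E * lebesgue_integral_rV (fun y =>
      (\1_(chart g p @` E) y * Num.sqrt (\det (local_gram p y)))%:E))%E.

Definition local_expr (p q : M) (f : M -> M) : 'rV[R]_n -> 'rV[R]_n :=
  chart g q \o f \o param g p.

(* for D open *)
Definition C1_on (D : set M) (f : M -> M) : Prop :=
  (forall x, D x -> {for x, continuous f}) /\
  forall p q, Ck 1 (chart g p @` (dom g p `&` D `&` f @^-1` dom g q))
                   (local_expr p q f).

Definition C1_holder (alpha : R) (f : M -> M) : Prop :=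
  C1_on setT f /\
  forall p q x, dom g p x -> dom g q (f x) ->
    exists2 B, nbhs (chart g p x) B & exists C : R,
      forall y z, B y -> B z ->
        `| 'J (local_expr p q f) y - 'J (local_expr p q f) z |
          <= C * `| y - z | `^ alpha.

Definition diffeo_on (U : set M) (f : M -> M) : Prop :=
  [/\ {in U &, injective f}, open (f @` U), C1_on U f &
      exists2 h : M -> M, (forall x, U x -> h (f x) = x) & C1_on (f @` U) h].

Definition local_diffeo (f : M -> M) : Prop :=
  forall x, exists U : set M, [/\ open U, U x & diffeo_on U f].

(* Matrices act on row vectors: Df(x) is u |-> u *m differential f x. *)
Definition differential (f : M -> M) (x : M) : 'M[R]_n :=
  'J (local_expr x (f x) f) (chart g x x).

(* operator norm of u |-> u *m A, from the tangent space at x to that at y *)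
Definition opnorm (x y : M) (A : 'M[R]_n) : R :=
  sup [set tnorm y (u *m A) | u in [set u | tnorm x u <= 1]].

Definition conformal_on (U : set M) (f : M -> M) : Prop :=
  forall x, U x -> exists (a : R) (I : 'M[R]_n),
    differential f x = a *: I /\
    forall u, tnorm (f x) (u *m I) = tnorm x u.

Definition rneighborhood (r : R) (V : set M) : set M :=
  [set y | exists2 x, V x & ball x r y].

Definition lebesgue_number (I : Type) (V : I -> set M) (eta : R) : Prop :=
  0 < eta /\ forall A : set M, diam A < eta -> exists i, A `<=` V i.

End Riemannian_geometry.

HB.instance Definition _ (m : nat) := isPointed.Build 'I_m.+1 ord0.

Definition fullshift (k : nat) : Type :=
  prod_topology (fun _ : int => discrete_topology 'I_k.+1).

HB.instance Definition _ k := Topological.on (fullshift k).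
HB.instance Definition _ k := Pointed.on (fullshift k).

Definition shiftn (k : nat) (m : nat) (s : fullshift k) : fullshift k :=
  fun l => s (l + m%:Z).

(* The ambient space of all the measures below is the product with the full
   shift.  The space Sigma_A x M is a closed subset of it whose Borel sets are
   the Borel subsets of the ambient space contained in it; the formula for F_A
   makes sense everywhere and preserves it. *)
Definition skew_space (k : nat) (R : realType) (M : pseudoPMetricType R) :
  Type :=
  (fullshift k * M)%type.

HB.instance Definition _ k R M := Topological.on (@skew_space k R M).
HB.instance Definition _ k R M := Pointed.on (@skew_space k R M).

(* The k > 1 generators are indexed by ['I_k.+1] with [0 < k]; a word
   (i_1, ..., i_n) is the list [:: i_1; ...; i_n]. *)

Section Semigroup.
Context {R : realType} {n : nat} {M : pseudoPMetricType R}.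
Variables (g : riemannian n M) (k : nat) (f : 'I_k.+1 -> M -> M).

Definition word := seq 'I_k.+1.

(* the first letter of the word acts first *)
Fixpoint fword (w : word) (x : M) : M :=
  if w is i :: w' then fword w' (f i x) else x.

Definition generated (S : set 'I_k.+1) : set (M -> M) :=
  [set h | exists2 w : word, (forall i, i \in w -> S i) & h = fword w].

Definition minimal_generators : Prop := forall i, ~ generated [set~ i] (f i).

Definition C1_holder_semigroup (alpha : R) : Prop :=
  [/\ (0 < k)%N,
      forall i, C1_holder g alpha (f i) /\ local_diffeo g (f i) &
      minimal_generators].

Record conformal_expanding := ConformalExpanding {
  vcenter : 'I_k.+1 -> M;
  vradius : 'I_k.+1 -> R;
  exp_sigma : R;
  exp_r : R;
  leb_eta : R;
  Vball := fun i => ball (vcenter i) (vradius i);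
  vradius_gt0 : forall i, 0 < vradius i;
  V_cover : forall x, exists i, Vball i x;
  sigma_lt1 : exp_sigma < 1;
  rr_gt0 : 0 < exp_r;
  V_diffeo : forall i, diffeo_on g (rneighborhood exp_r (Vball i)) (f i);
  V_expanding : forall i x, rneighborhood exp_r (Vball i) x ->
    opnorm g (f i x) x (invmx (differential g (f i) x)) < exp_sigma;
  V_conformal : forall i, conformal_on g (rneighborhood exp_r (Vball i)) (f i);
  V_diam : forall i, diam g (Vball i) < exp_r;
  eta_lt : leb_eta < exp_r / 2;
  eta_lebesgue : lebesgue_number g Vball leb_eta
}.

Variable ce : conformal_expanding.

Fixpoint admissible_rec (w : word) (x : M) : Prop :=
  if w is i :: w' then Vball ce i x /\ admissible_rec w' (f i x) else True.

Definition admissible (w : word) (x : M) : Prop :=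
  w != [::] /\ admissible_rec w x.

(* f_w^{-n}(B): the successive images of B under the inverses of the
   restrictions of f_{i_n}, ..., f_{i_1} to the B_r(V_{i_j}). *)
Fixpoint inverse_branch (w : word) (B : set M) : set M :=
  if w is i :: w' then
    rneighborhood (exp_r ce) (Vball ce i) `&` f i @^-1` inverse_branch w' B
  else B.

(* The mixing condition is about nonempty open sets: for U empty it fails
   trivially. *)
Definition topologically_mixing : Prop :=
  forall U U' : set M, open U -> open U' -> U !=set0 -> U' !=set0 ->
    diam g U < leb_eta ce / 2 -> diam g U' < leb_eta ce / 2 ->
    exists (w : word) (x : M) (s : R),
      [/\ admissible w x, s < leb_eta ce, U' `<=` ball (fword w x) s &
          inverse_branch w (ball (fword w x) s) `<=` U].

Definition countable_markov_partition (lambda : probability (borel M) R)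
    (Mi : nat -> set M) (h : nat -> M -> M) : Prop :=
  [/\ forall i, generated setT (h i),
      lambda (~` \bigcup_i Mi i) = 0%E,
      forall i, Mi i = closure ((Mi i)^°),
      forall i j, i <> j -> (Mi i)^° `&` (Mi j)^° = set0 &
      forall i j, (Mi i)^° `&` h i @^-1` (Mi j)^° !=set0 ->
        Mi j `<=` h i @` Mi i].

Record inducing_scheme (lambda : probability (borel M) R) := InducingScheme {
  Mi : nat -> set M;
  wd : nat -> word;
  hmap := fun i => fword (wd i);
  Mi_markov : countable_markov_partition lambda Mi hmap;
  nballs : nat;
  bcenter : 'I_nballs -> M;
  eps : R;
  Bset := fun j => ball (bcenter j) eps;
  eps_gt0 : 0 < eps;
  eps_le : eps <= leb_eta ce / 6;
  Bset_cover : forall x, exists j, Bset j x;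
  target : nat -> 'I_nballs;
  (* the inverse branch is the one on a ball of radius < eta around the
     endpoint of an admissible orbit, restricted to [Bset (target i)] *)
  wd_branch : forall i, exists (x : M) (s : R),
    [/\ admissible (wd i) x, s < leb_eta ce,
        Bset (target i) `<=` ball (fword (wd i) x) s &
        Mi i = closure (inverse_branch (wd i) (Bset (target i)))];
  hmap_target : forall i, hmap i @` (Mi i)^° = Bset (target i);
  Mi_diam : exists2 delta : R, lebesgue_number g Bset delta &
    forall i, diam g (Mi i) < delta;
  cyc : 'I_nballs -> nat;
  cyc_sub : forall j, Mi (cyc j) `<=` Bset j;
  (* [ordS] is the cyclic successor *)
  cyc_image : forall j, hmap (cyc j) @` (Mi (cyc j))^° = Bset (ordS j)
}.

Context {lambda : probability (borel M) R}.
Variable S : inducing_scheme lambda.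

(* tau(x) = |h_i| for the i, unique if any, with x in the interior of M_i *)
Definition tau (x : M) : nat :=
  if `[< exists i, (Mi S i)^° x >]
  then size (wd S (get [set i | (Mi S i)^° x])) else 0.

Definition trans (i j : nat) : Prop :=
  (Mi S i)^° `&` hmap S i @^-1` (Mi S j)^° !=set0.

Definition SigmaInd : set (int -> nat) :=
  [set s | forall l : int, trans (s l) (s (l + 1))].

Definition cylinder (i : nat) : set (int -> nat) :=
  [set s | SigmaInd s /\ s 0 = i].

(* Concatenation of the words w_{i_l}, l in Z, the word w_{i_0} starting at
   position 0.  As words are nonempty, the letter at position m >= 0 lies in
   the first m+1 blocks w_{i_0} ... w_{i_m}, and the one at position -(m+1)
   (which is [Negz m]) lies in the m+1 blocks w_{i_{-m-1}} ... w_{i_{-1}}, where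
   it is the m-th letter (from 0) from the right. *)
Definition rho (s : int -> nat) : fullshift k := fun l =>
  match l with
  | Posz m => nth ord0 (flatten [seq wd S (s (Posz j)) | j <- iota 0 m.+1]) m
  | Negz m => nth ord0
      (rev (flatten [seq wd S (s (Negz j)) | j <- rev (iota 0 m.+1)])) m
  end.

Definition SigmaA : set (fullshift k) :=
  [set j | forall l : int,
     f (j l) @` Vball ce (j l) `&` Vball ce (j (l + 1)) !=set0].

(* rho takes its values in Sigma_A and is injective *)
Definition rho_wf : Prop :=
  (forall s, SigmaInd s -> SigmaA (rho s)) /\
  (forall s t, SigmaInd s -> SigmaInd t -> rho s = rho t -> s = t).

Local Notation skewT := (skew_space k M).

Definition SigmaAM : set skewT := SigmaA `*` setT.

Definition FA (z : skewT) : skewT := (shiftn 1 z.1, f (z.1 0) z.2).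

(* f_j^m = f_{j_{m-1}} o ... o f_{j_0} *)
Definition fseq (j : fullshift k) (m : nat) : M -> M :=
  fword (mkseq (fun l => j (Posz l)) m).

Definition block (i : nat) : set skewT := (rho @` cylinder i) `*` Mi S i.

Definition WW : set skewT := \bigcup_i block i.

(* zeroth digit of rho^{-1}(j), for j in the image of rho *)
Definition digit0 (j : fullshift k) : nat :=
  get [set i | (rho @` cylinder i) j].

Definition psi (z : skewT) : nat :=
  if `[< (Mi S (digit0 z.1))^° z.2 >] then tau z.2 else 0.

(* relevant on WW only; FApsi need not map WW into itself *)
Definition FApsi (z : skewT) : skewT :=
  if `[< (Mi S (digit0 z.1))^° z.2 >]
  then (shiftn (tau z.2) z.1, fseq z.1 (tau z.2) z.2) else z.

Definition FApsi_preimage (E : set skewT) : set skewT := WW `&` FApsi @^-1` E.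

Definition FA_preimage (E : set skewT) : set skewT := SigmaAM `&` FA @^-1` E.

Definition YY : set skewT :=
  [set z | exists z0 l, [/\ WW z0, (l < psi z0)%N & z = iter l FA z0]].

(* The sets WW, YY, block i and the preimages above are Borel: rho is
   continuous and injective on a closed subset of a Polish space, so that it
   sends Borel sets to Borel sets (Lusin-Souslin). *)

Section Measures.
Variable m : probability (borel skewT) R.

Definition topological_support : set skewT :=
  [set z | forall U : set skewT, open U -> U z -> (0 < m U)%E].

Definition supported_in_WW : Prop :=
  m (~` WW) = 0%E /\ topological_support `<=` WW.

Definition FApsi_invariant : Prop :=
  forall E : set (borel skewT), measurable E -> m (FApsi_preimage E) = m E.

(* Sets invariant modulo m are considered because FApsi is only partially
   iterable. *)
Definition FApsi_ergodic : Prop :=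
  forall E : set (borel skewT), measurable E ->
    m (E `\` FApsi_preimage E) = 0%E -> m (FApsi_preimage E `\` E) = 0%E ->
    m E = 0%E \/ m E = 1%E.

Definition Qm : \bar R := (\int[m]_(z in WW) (psi z)%:R%:E)%E.

(* the set function L(m), on subsets of YY *)
Definition lifted (E : set skewT) : \bar R :=
  ((fine Qm)^-1%:E *
   \sum_(0 <= i <oo) \sum_(l < size (wd S i))
     m ((iter l FA) @^-1` E `&` block i))%E.

(* L(m), extended by 0 off YY, is a measure, and it is invariant under F_A *)
Definition lifted_is_invariant_measure : Prop :=
  exists nu : {measure set (borel skewT) -> \bar R},
    (forall E : set (borel skewT), measurable E -> nu E = lifted (E `&` YY)) /\
    (forall E : set (borel skewT), measurable E -> E `<=` SigmaAM ->
       nu (FA_preimage E) = nu E).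

End Measures.

End Semigroup.

(* Main.v *)
(** The measure is carried by a periodic orbit. The inverse branches of the
    words w_{b_1}, ..., w_{b_N} of the finite cycle map B_{j+1} into
    M_{b_j}, which lies in B_j, and contract the Riemannian distance, so that there are
    points x_j in the interior of M_{b_j} with h_{b_j}(x_j) = x_{j+1}. Pairing
    x_j with the concatenation of the periodic sequence of words read from b_j
    on gives a periodic orbit of the induced map, along which psi is bounded,
    and its uniform measure is invariant and ergodic. The lift is the
    normalized sum of the Dirac masses along the corresponding F_A-orbit.

    The contraction is obtained by lifting curves: the pieces of a path are
    pulled back by an inverse branch as long as the lift stays in the domain
    of conformal expansion, and the length of the lift is at most sigma times
    the original one. *)

Require Import Defs.
From HB Require Import structures.
From mathcomp Require Import all_boot all_order all_algebra.
From mathcomp Require Import all_classical all_reals all_analysis.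

Set Implicit Arguments.
Unset Strict Implicit.
Unset Printing Implicit Defensive.

Import Order.TTheory GRing.Theory Num.Theory.
Import numFieldNormedType.Exports.
From mathcomp Require Import measurable_realfun zify ring lra.

Local Open Scope classical_set_scope.
Local Open Scope ring_scope.

(** * Calculus along curves *)

Section calculus_along_curves.
Context {R : realType}.

Lemma cvg_sum_seq (V : normedModType R) (T I : Type) (F : set_system T)
    {FF : Filter F} (r : seq I) (f : I -> T -> V) (l : I -> V) :
  (forall i, f i t @[t --> F] --> l i) ->
  \sum_(i <- r) f i t @[t --> F] --> \sum_(i <- r) l i.
Proof. by move=> fl; apply: cvg_big => // -[x y]; exact: add_continuous. Qed.

Lemma cvg_mx_entries (T : Type) (F : set_system T) {FF : Filter F} m n
    (A : T -> 'M[R]_(m, n)) (B : 'M[R]_(m, n)) :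
  (forall i j, A t i j @[t --> F] --> B i j) -> A t @[t --> F] --> B.
Proof.
move=> AB; rewrite (matrix_sum_delta B).
rewrite (_ : A = fun t => \sum_i \sum_j A t i j *: delta_mx i j); last first.
  by apply/funext => t; exact: matrix_sum_delta.
apply: cvg_sum_seq => i; apply: cvg_sum_seq => j.
by apply: cvgZr_tmp; exact: AB.
Qed.

Lemma cvg_mx_entry (T : Type) (F : set_system T) {FF : Filter F} m n
    (A : T -> 'M[R]_(m, n)) (B : 'M[R]_(m, n)) i j :
  A t @[t --> F] --> B -> A t i j @[t --> F] --> B i j.
Proof.
move=> AB; apply: (@cvg_comp _ _ _ A (fun M => M i j) _ _ _ AB).
exact: coord_continuous.
Qed.

Lemma cvg_mulmx (T : Type) (F : set_system T) {FF : Filter F} m n p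
    (A : T -> 'M[R]_(m, n)) (B : T -> 'M[R]_(n, p))
    (A0 : 'M[R]_(m, n)) (B0 : 'M[R]_(n, p)) :
  A t @[t --> F] --> A0 -> B t @[t --> F] --> B0 ->
  A t *m B t @[t --> F] --> A0 *m B0.
Proof.
move=> cA cB; apply: cvg_mx_entries => i j; rewrite mxE.
rewrite (_ : (fun t => _) = fun t => \sum_k A t i k * B t k j); last first.
  by apply/funext => t; rewrite mxE.
by apply: cvg_sum_seq => k; apply: cvgM; exact: cvg_mx_entry.
Qed.

Lemma cvg_trmx (T : Type) (F : set_system T) {FF : Filter F} m n
    (A : T -> 'M[R]_(m, n)) (A0 : 'M[R]_(m, n)) :
  A t @[t --> F] --> A0 -> (A t)^T @[t --> F] --> A0^T.
Proof.
move=> cA; apply: cvg_mx_entries => i j; rewrite mxE.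
rewrite (_ : (fun t => _) = fun t => A t j i); last first.
  by apply/funext => t; rewrite mxE.
exact: cvg_mx_entry.
Qed.

Lemma derive1_comp_curve m n (E : 'rV[R]_m -> 'rV[R]_n) (F : R -> 'rV[R]_m) t :
  derivable F t 1 -> differentiable E (F t) ->
  derivable (E \o F) t 1 /\
  derive1 (E \o F) t = derive1 F t *m 'J E (F t).
Proof.
move=> /derivable1_diffP dF dE; split.
  by apply/derivable1_diffP; exact: differentiable_comp.
rewrite (derive1E' (differentiable_comp dF dE)) (diff_comp dF dE).
by rewrite (derive1E' dF) -(deriveEjacobian _ dE) (deriveE _ dE).
Qed.

Lemma derive1_comp_scalar (V : normedModType R) (F : R -> V) (h : R -> R) t :
  derivable h t 1 -> derivable F (h t) 1 ->
  derivable (F \o h) t 1 /\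
  derive1 (F \o h) t = derive1 h t *: derive1 F (h t).
Proof.
move=> /derivable1_diffP dh /derivable1_diffP dF; split.
  by apply/derivable1_diffP; exact: differentiable_comp.
rewrite (derive1E' (differentiable_comp dh dF)) (diff_comp dh dF).
rewrite (derive1E' dh) (derive1E' dF) -linearZ /=.
by congr ('d F _ _); rewrite [RHS]mulr1.
Qed.

(** [Ck 1] gives continuity of the directional derivatives. The entries of the Jacobian are their
    components along the basis vectors, and this holds near [x] because [D] is open. *)
Lemma Ck1_jacobian_continuous m n (D : set 'rV[R]_m) (E : 'rV[R]_m -> 'rV[R]_n)
    x : open D -> Ck 1 D E -> D x -> {for x, continuous (jacobian E)}.
Proof.
move=> oD [dE cE] Dx.
apply: (@cvg_mx_entries _ (nbhs x) _ m n (jacobian E)) => i j.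
have key y : D y -> 'J E y i j = 'D_(delta_mx 0 i) E y 0 j.
  move=> Dy; rewrite deriveEjacobian; last exact: dE.
  by rewrite -rowE [RHS]mxE.
have cD : 'D_(delta_mx 0 i) E y @[y --> x] --> 'D_(delta_mx 0 i) E x.
  exact: (cE (delta_mx 0 i) x Dx).
have cDj : 'D_(delta_mx 0 i) E y 0 j @[y --> x] --> jacobian E x i j.
  rewrite (key _ Dx).
  exact: (@cvg_mx_entry _ (nbhs x) _ _ _ _ _ 0 j cD).
apply: cvg_trans cDj.
apply: near_eq_cvg.
apply: filterS (open_nbhs_nbhs (conj oD Dx)) => y Dy.
exact/esym/key.
Qed.

Lemma C1_comp_curve m n (D : set 'rV[R]_m) (E : 'rV[R]_m -> 'rV[R]_n)
    (F : R -> 'rV[R]_m) t : open D -> Ck 1 D E -> D (F t) ->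
  (\forall s \near t, derivable F s 1) -> {for t, continuous (derive1 F)} ->
  derivable (E \o F) t 1 /\ {for t, continuous (derive1 (E \o F))}.
Proof.
move=> oD [dE cE] DFt dF cF.
have dFt := nbhs_singleton dF.
have cFt : F s @[s --> t] --> F t.
  by apply: differentiable_continuous; apply/derivable1_diffP.
have ev : \forall s \near t, D (F s).
  by apply: (cFt D); exact: open_nbhs_nbhs.
have [d1 e1] := derive1_comp_curve dFt (dE _ DFt).
split; first exact: d1.
have cJ : 'J E (F s) @[s --> t] --> 'J E (F t).
  by apply: cvg_comp cFt _; exact: Ck1_jacobian_continuous DFt.
have cm : derive1 F s *m 'J E (F s) @[s --> t] -->
    derive1 F t *m 'J E (F t) by exact: cvg_mulmx cF cJ.
rewrite /prop_for /continuous_at e1; apply: (cvg_trans _ cm).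
apply: near_eq_cvg; apply: filterS2 dF ev => s dFs DFs.
exact: esym (derive1_comp_curve dFs (dE _ DFs)).2.
Qed.

Lemma near_eq_derive1 (V : normedModType R) (F G : R -> V) t :
  (\forall s \near t, F s = G s) -> derive1 F t = derive1 G t.
Proof. by move=> FG; rewrite !derive1E; exact: near_eq_derive. Qed.

Lemma near_eq_C1 (V : normedModType R) (F G : R -> V) t :
  (\forall s \near t, F s = G s) ->
  derivable F t 1 /\ {for t, continuous (derive1 F)} ->
  derivable G t 1 /\ {for t, continuous (derive1 G)}.
Proof.
move=> FG [dF cF]; split; first exact: near_eq_derivable dF.
rewrite /prop_for /continuous_at -(near_eq_derive1 FG).
apply: (cvg_trans _ cF); apply: near_eq_cvg.
move/nbhs_interior: FG; apply: filterS => s.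
by move=> ?; exact: near_eq_derive1.
Qed.

Lemma C1_comp_scalar (V : normedModType R) (F : R -> V) (h : R -> R) t :
  (forall s, derivable h s 1) -> continuous (derive1 h) ->
  (\forall s \near h t, derivable F s 1) ->
  {for h t, continuous (derive1 F)} ->
  (\forall s \near t, derivable (F \o h) s 1) /\
  {for t, continuous (derive1 (F \o h))}.
Proof.
move=> dh ch dF cF.
have cht : h s @[s --> t] --> h t.
  by apply: differentiable_continuous; apply/derivable1_diffP.
have ev : \forall s \near t, derivable F (h s) 1 by exact: (cht _ dF).
split; first by apply: filterS ev => s ds; exact: (derive1_comp_scalar (dh s) ds).1.
have cFh : derive1 F (h s) @[s --> t] --> derive1 F (h t).
  exact: cvg_comp cht cF.
have cm : derive1 h s *: derive1 F (h s) @[s --> t] -->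
    derive1 h t *: derive1 F (h t) by exact: cvgZ (ch t) cFh.
rewrite /prop_for /continuous_at.
rewrite (derive1_comp_scalar (dh t) (nbhs_singleton dF)).2.
apply: (cvg_trans _ cm); apply: near_eq_cvg; apply: filterS ev => s ds.
exact: esym (derive1_comp_scalar (dh s) ds).2.
Qed.

End calculus_along_curves.

(** * Curves on a Riemannian manifold *)

Lemma open_preimage_on (X Y : topologicalType) (D : set X) (h : X -> Y)
    (O : set Y) : open D -> (forall x, D x -> {for x, continuous h}) ->
  open O -> open (D `&` h @^-1` O).
Proof.
move=> oD ch oO; rewrite openE => x [Dx Ox].
apply: filterI; first exact: (open_nbhs_nbhs (conj oD Dx)).
exact: (ch x Dx _ (open_nbhs_nbhs (conj oO Ox))).
Qed.

Section curves.
Context {R : realType} {n : nat} {M : pseudoPMetricType R}.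
Variable g : riemannian n M.

(** Near a point of the image, [param g p] is a continuous inverse of the chart and brings vectors
    back into [A]. *)
Lemma open_chart_image p (A : set M) : open A -> A `<=` dom g p ->
  open (chart g p @` A).
Proof.
move=> oA Ap; rewrite openE => _ [x Ax <-].
have oC := @chart_open _ _ _ g p.
have Cx : (chart g p @` dom g p) (chart g p x) by exists x => //; exact: Ap.
have pA : \forall z \near chart g p x, A (param g p z).
  apply: (param_continuous Cx); rewrite /= chartK; last exact: Ap.
  exact: open_nbhs_nbhs.
apply: filterS2 pA (open_nbhs_nbhs (conj oC Cx)) => z + [y py zE].
by rewrite -zE chartK// => Ay; exists y.
Qed.

Lemma tnorm_ge0 x u : 0 <= tnorm g x u.
Proof. exact: sqrtr_ge0. Qed.

Lemma tnormZ x a u : tnorm g x (a *: u) = `|a| * tnorm g x u.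
Proof.
rewrite /tnorm linearZ /= -!scalemxAl -scalemxAr scalerA mxE.
by rewrite -expr2 sqrtrM ?sqr_ge0// sqrtr_sqr.
Qed.

Lemma C1_curve_near c p t : C1_curve g c -> dom g p (c t) ->
  \forall s \near t, dom g p (c s).
Proof.
by move=> [cc _] dt; apply: (cc t); apply: open_nbhs_nbhs; split=> //; exact: dom_open.
Qed.

Lemma C1_curve_derivable_near c p t : C1_curve g c -> dom g p (c t) ->
  \forall s \near t, derivable (chart g p \o c) s 1.
Proof.
move=> cC dt; apply: filterS (C1_curve_near cC dt) => s ds.
exact: (cC.2 p s ds).1.
Qed.

(** [speed] uses at each time the chart centred at the moving point, which hides its continuity. The
    chain rule through the transition map carries the velocity to a fixed chart. *)
Lemma speed_chart c p t : C1_curve g c -> dom g p (c t) ->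
  let v := derive1 (chart g p \o c) t in
  speed g c t =
    Num.sqrt ((v *m local_gram g p (chart g p (c t)) *m v^T) 0 0).
Proof.
move=> cC dt v.
rewrite /speed /tnorm /local_gram (chartK dt) /=.
set q := c t; set J := 'J _ _.
have oQ : open (chart g p @` (dom g p `&` dom g q)).
  apply: open_chart_image; last by move=> x [].
  by apply: openI; exact: dom_open.
have [dE _] := transition_smooth g p q 1.
have [_ e] := derive1_comp_curve (cC.2 p t dt).1
  (dE (chart g p (c t)) (imageP _ (conj dt (dom_center g q)))).
have -> : derive1 (chart g q \o c) t = v *m J.
  rewrite -e; apply: near_eq_derive1.
  by apply: filterS (C1_curve_near cC dt) => s ds /=; rewrite chartK.
by rewrite trmx_mul !mulmxA.
Qed.

Lemma speed_continuous c : C1_curve g c -> continuous (speed g c).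
Proof.
move=> cC t; set p := c t.
have dt : dom g p (c t) by exact: dom_center.
have oC := @chart_open _ _ _ g p.
pose v s := derive1 (chart g p \o c) s.
pose G s := local_gram g p (chart g p (c s)).
have cv : v s @[s --> t] --> v t by exact: (cC.2 p t dt).2.
have cchart : chart g p (c s) @[s --> t] --> chart g p (c t).
  by apply: cvg_comp (cC.1 t) _; exact: chart_continuous.
have cG : G s @[s --> t] --> G t.
  (* Smoothness of order 0 of the metric is the continuity of [local_gram g p]. *)
  by apply: cvg_comp cchart _; apply: (gram_smooth g p 0); exists p.
have cq : (v s *m G s *m (v s)^T) 0 0 @[s --> t] -->
    (v t *m G t *m (v t)^T) 0 0.
  apply: (@cvg_mx_entry _ _ (nbhs t) _ _ _ (fun s => v s *m G s *m (v s)^T)).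
  apply: (@cvg_mulmx _ _ (nbhs t) _ _ _ _ (fun s => v s *m G s)).
    exact: cvg_mulmx.
  exact: cvg_trmx.
rewrite /continuous_at (speed_chart cC dt).
have cs : Num.sqrt ((v s *m G s *m (v s)^T) 0 0) @[s --> t] -->
    Num.sqrt ((v t *m G t *m (v t)^T) 0 0).
  by apply: cvg_comp cq _; exact: sqrt_continuous.
apply: (cvg_trans _ cs); apply: near_eq_cvg.
apply: filterS (C1_curve_near cC dt) => s ds.
exact/esym/speed_chart.
Qed.

Lemma speed_integrable c a b : C1_curve g c ->
  (@lebesgue_measure R).-integrable `[a, b] (EFin \o speed g c).
Proof.
move=> cC; apply: continuous_compact_integrable; first exact: segment_compact.
exact/continuous_subspaceT/speed_continuous.
Qed.

Lemma speed_ge0 c t : 0 <= speed g c t.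
Proof. exact: tnorm_ge0. Qed.

Lemma curve_length_ge0 c : 0 <= curve_length g c.
Proof. by apply: Rintegral_ge0 => t _; exact: speed_ge0. Qed.

(** A [C1_curve] is C^1 on the whole line, so its image is one only if it never leaves [D]; the
    reparametrization [h] serves to ensure this. Near each time the rest is the chain rule for the
    expression of [phi] in the chart at [c (h t)]. *)
Lemma C1_curve_image (D : set M) (phi : M -> M) c (h : R -> R) : open D ->
  C1_on g D phi -> C1_curve g c ->
  (forall t, derivable h t 1) -> continuous (derive1 h) ->
  (forall t, D (c (h t))) ->
  C1_curve g (phi \o c \o h) /\
  forall t, speed g (phi \o c \o h) t =
    tnorm g (phi (c (h t)))
      ((derive1 h t *: derive1 (chart g (c (h t)) \o c) (h t)) *m
        differential g phi (c (h t))).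
Proof.
move=> oD [cphi C1phi] cC dh ch Dch.
have cch : continuous (c \o h).
  move=> t; have cht : h s @[s --> t] --> h t.
    by apply: differentiable_continuous; exact/derivable1_diffP.
  by apply: cvg_comp cht _; exact: cC.1.
pose A x p := dom g x `&` D `&` phi @^-1` dom g p.
have oA x p : open (A x p).
  rewrite /A -setIA; apply: openI; first exact: dom_open.
  by apply: open_preimage_on => //; exact: dom_open.
pose Om x p := chart g x @` A x p.
have oOm x p : open (Om x p).
  by apply: open_chart_image => // y [[]].
have Ach t p : dom g p (phi (c (h t))) -> A (c (h t)) p (c (h t)).
  by move=> dp; split=> //; split=> //; exact: dom_center.
have FC t := C1_comp_scalar dh ch
  (C1_curve_derivable_near cC (dom_center g (c (h t))))
  (cC.2 _ _ (dom_center g (c (h t)))).2.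
have E t p : dom g p (phi (c (h t))) -> \forall s \near t,
    (local_expr g (c (h t)) p phi \o (chart g (c (h t)) \o c \o h)) s =
    (chart g p \o (phi \o c \o h)) s.
  move=> dp.
  have : \forall s \near t, A (c (h t)) p (c (h s)).
    apply: (cch t); apply: open_nbhs_nbhs; split; [exact: oA|exact: Ach].
  by apply: filterS => s [[ds _] _] /=; rewrite /local_expr /= chartK.
split.
  split.
    move=> t; apply: (@cvg_comp _ _ _ (c \o h) phi _ _ _ (cch t)).
    exact: cphi.
  move=> p t dp; apply: (near_eq_C1 (E t p dp)).
  apply: (@C1_comp_curve _ _ _ (Om (c (h t)) p)) => //.
  - exact: C1phi.
  - by exists (c (h t)) => //; exact: Ach.
  - exact: (FC t).1.
  - exact: (FC t).2.
move=> t; rewrite /speed; set p := (phi \o c \o h) t.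
have dp : dom g p (phi (c (h t))) by exact: dom_center.
rewrite -(near_eq_derive1 (E t p dp)).
have [dE _] := C1phi (c (h t)) p.
rewrite (derive1_comp_curve (nbhs_singleton (FC t).1) _).2; last first.
  by apply: dE; exists (c (h t)) => //; exact: Ach.
congr (tnorm g _ (_ *m _)).
by rewrite (derive1_comp_scalar (dh t)
  (nbhs_singleton (C1_curve_derivable_near cC (dom_center g (c (h t)))))).2.
Qed.

End curves.

(** * Reparametrization of curves by a smooth ramp *)

Section cosine_ramp.
Context {R : realType}.
Variable T : R.

(* A C^1 map from the whole line into [0, T]: composing with it turns a curve
   that is only controlled on [0, T] into a [C1_curve], which must be C^1 on
   the whole line. *)
Definition cosine_ramp (t : R) : R := T / 2 * (1 - cos (pi * t)).

Lemma is_derive_cosine_ramp (t : R) :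
  is_derive t 1 cosine_ramp (T / 2 * (pi * sin (pi * t))).
Proof.
have dl : is_derive t 1 (fun s : R => pi * s) pi.
  have d := is_deriveZ pi (is_derive_id t (1 : R)).
  by apply: is_derive_eq d _; exact: mulr1.
have dc := is_derive1_comp (is_derive_cos (pi * t)) dl.
have d1 := is_deriveB (is_derive_cst (1 : R) t 1) dc.
apply: is_derive_eq (is_deriveZ (T / 2) d1) _; congr (_ * _).
by rewrite sub0r mulNr opprK [sin _ * _]mulrC.
Qed.

Lemma derivable_cosine_ramp (t : R) : derivable cosine_ramp t 1.
Proof. by have [] := is_derive_cosine_ramp t. Qed.

Lemma derive1_cosine_ramp t :
  derive1 cosine_ramp t = T / 2 * (pi * sin (pi * t)).
Proof. by rewrite derive1E; have [] := is_derive_cosine_ramp t. Qed.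

Lemma continuous_cosine_ramp : continuous cosine_ramp.
Proof.
move=> t; apply: differentiable_continuous.
exact/derivable1_diffP/derivable_cosine_ramp.
Qed.

Lemma continuous_derive1_cosine_ramp : continuous (derive1 cosine_ramp).
Proof.
have -> : derive1 cosine_ramp = fun t => T / 2 * (pi * sin (pi * t)).
  by apply/funext => t; exact: derive1_cosine_ramp.
move=> t; apply: cvgM; first exact: cvg_cst.
apply: cvgM; first exact: cvg_cst.
have cl : pi * s @[s --> t] --> pi * t by apply: cvgM; [exact: cvg_cst|exact: cvg_id].
by apply: cvg_comp cl _; exact: continuous_sin.
Qed.

Lemma cosine_ramp0 : cosine_ramp 0 = 0.
Proof. by rewrite /cosine_ramp mulr0 cos0 subrr mulr0. Qed.

Lemma cosine_ramp1 : cosine_ramp 1 = T.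
Proof. by rewrite /cosine_ramp mulr1 cospi opprK -mulrA mulVf ?mulr1// pnatr_eq0. Qed.

Lemma cosine_ramp_itv t : 0 <= T -> 0 <= cosine_ramp t <= T.
Proof.
move=> T0; have := cos_le1 (pi * t); have := cos_geN1 (pi * t).
rewrite /cosine_ramp => h1 h2; apply/andP; split.
  by rewrite mulr_ge0 ?divr_ge0// subr_ge0.
have : T / 2 * (1 - cos (pi * t)) <= T / 2 * 2.
  by rewrite ler_wpM2l ?divr_ge0//; lra.
by rewrite [T / 2 * 2]divfK// pnatr_eq0.
Qed.

Lemma derive1_cosine_ramp_ge0 t : 0 <= T -> 0 <= t <= 1 ->
  0 <= derive1 cosine_ramp t.
Proof.
move=> T0 /andP[t0 t1]; rewrite derive1_cosine_ramp.
rewrite !mulr_ge0 ?invr_ge0 ?pi_ge0//.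
apply: sin_ge0_pi; rewrite mulr_ge0 ?pi_ge0//=.
by rewrite ler_piMr ?pi_ge0.
Qed.

Lemma cosine_ramp_increasing : 0 < T ->
  {in `[0, 1] &, {homo cosine_ramp : x y / x < y}}.
Proof.
move=> T0 x y; rewrite !in_itv /= => /andP[x0 x1] /andP[y0 y1] xy.
have mem z : 0 <= z -> z <= 1 -> pi * z \in `[0, (pi : R)].
  by move=> z0 z1; rewrite in_itv /= mulr_ge0 ?pi_ge0//= ler_piMr ?pi_ge0.
rewrite /cosine_ramp ltr_pM2l ?divr_gt0// ltrD2l ltrN2.
by rewrite (ltr_cos (mem _ x0 x1) (mem _ y0 y1)) /= ltr_pM2l ?pi_gt0.
Qed.

Lemma integral_cosine_ramp (G : R -> R) : 0 < T -> continuous G ->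
  (\int[@lebesgue_measure R]_(x in `[0%R, T]) (G x)%:E =
   \int[@lebesgue_measure R]_(x in `[0%R, 1%R])
     (G (cosine_ramp x) * derive1 cosine_ramp x)%:E)%E.
Proof.
move=> T0 cG.
have := @integration_by_substitution_increasing R cosine_ramp G 0 1.
rewrite cosine_ramp0 cosine_ramp1; apply.
- exact: ler01.
- exact: cosine_ramp_increasing.
- by move=> x _; exact: continuous_derive1_cosine_ramp.
- apply/cvg_ex; exists (derive1 cosine_ramp 0).
  by apply: cvg_at_right_filter; exact: continuous_derive1_cosine_ramp.
- apply/cvg_ex; exists (derive1 cosine_ramp 1).
  by apply: cvg_at_left_filter; exact: continuous_derive1_cosine_ramp.
- split; first by move=> x _; exact: derivable_cosine_ramp.
    by apply: cvg_at_right_filter; exact: continuous_cosine_ramp.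
  by apply: cvg_at_left_filter; exact: continuous_cosine_ramp.
- exact: continuous_subspaceT.
Qed.

End cosine_ramp.

(** * Lengths of images of curves *)

Section distance.
Context {R : realType} {n : nat} {M : pseudoPMetricType R}.
Variable g : riemannian n M.

Lemma piecewise_C1_ge0 x y l : piecewise_C1 g x y l -> 0 <= l.
Proof.
by elim=> // c z m _ _ m0; rewrite addr_ge0//; exact: curve_length_ge0.
Qed.

Lemma rdist_le_length x y l : piecewise_C1 g x y l -> rdist g x y <= l.
Proof.
move=> xyl; apply: ge_inf => //; exists 0 => m; exact: piecewise_C1_ge0.
Qed.

(** Composed with the ramp, [c] stays in [D] at all times, so [phi \o c \o h] is a curve joining the
    two points. Its speed is at most [kap] times the speed of [c] at [h t] times the derivative of
    [h], and a substitution bounds its length by [kap] times the length of [c] over [0, T]. *)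
Lemma rdist_image_curve (D : set M) (phi : M -> M) (kap : R) c T :
  open D -> C1_on g D phi -> 0 <= kap ->
  (forall x u, D x ->
    tnorm g (phi x) (u *m differential g phi x) <= kap * tnorm g x u) ->
  C1_curve g c -> 0 <= T <= 1 -> (forall t, 0 <= t <= T -> D (c t)) ->
  rdist g (phi (c 0)) (phi (c T)) <= kap * curve_length g c.
Proof.
(* The case T = 0 is treated apart: the ramp is then constant and the substitution does not
   apply. *)
move=> oD C1phi kap0 kapP cC /andP[]; rewrite le_eqVlt => /predU1P[<- _ _|T0 T1 DT].
  apply: (@le_trans _ _ 0); first by apply: rdist_le_length; exact: piecewise_nil.
  by rewrite mulr_ge0// curve_length_ge0.
pose h := cosine_ramp T.
have [gC gS] := C1_curve_image oD C1phi cC (@derivable_cosine_ramp R T)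
  (@continuous_derive1_cosine_ramp R T)
  (fun t => DT _ (cosine_ramp_itv t (ltW T0))).
have := rdist_le_length (piecewise_cons gC (piecewise_nil g _)).
rewrite /= cosine_ramp0 cosine_ramp1 addr0 => /le_trans; apply.
pose S t := speed g c (h t) * derive1 h t.
have Sc : continuous S.
  move=> t; apply: cvgM; last exact: continuous_derive1_cosine_ramp.
  have ch : h s @[s --> t] --> h t by exact: continuous_cosine_ramp.
  by apply: cvg_comp ch _; exact: speed_continuous.
have Si : (@lebesgue_measure R).-integrable `[0, 1] (EFin \o S).
  apply: continuous_compact_integrable; first exact: segment_compact.
  exact: continuous_subspaceT.
apply: (@le_trans _ _ (\int[@lebesgue_measure R]_(t in `[0, 1]) (kap * S t))).
  apply: le_Rintegral => //; first exact: speed_integrable.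
    apply: continuous_compact_integrable; first exact: segment_compact.
    by apply: continuous_subspaceT => t; apply: cvgM; [exact: cvg_cst|exact: Sc].
  move=> t t01; have {}t01 : 0 <= t <= 1 by move: t01; rewrite /= in_itv.
  rewrite -[leLHS]/(speed g (phi \o c \o h) t) gS.
  apply: (le_trans (kapP _ _ (DT _ (cosine_ramp_itv t (ltW T0))))).
  rewrite tnormZ ger0_norm ?derive1_cosine_ramp_ge0 ?(ltW T0)//.
  by rewrite le_eqVlt; apply/orP; left; apply/eqP; congr (_ * _); exact: mulrC.
rewrite RintegralZl//; apply: ler_wpM2l => //.
rewrite /Rintegral /S -integral_cosine_ramp//; last exact: speed_continuous.
have iT := speed_integrable 0 T cC; have i1 := speed_integrable 0 1 cC.
apply: fine_le.
- exact: integrable_fin_num iT.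
- exact: integrable_fin_num i1.
- apply: ge0_subset_integral => //.
  + exact: measurable_int i1.
  + by move=> t _; rewrite lee_fin speed_ge0.
  + by apply: subset_itvl; rewrite bnd_simp.
Qed.

End distance.

(** * Riemannian distance and lifting of paths *)

Section metric.
Context {R : realType} {n : nat} {M : pseudoPMetricType R}.
Variables (g : riemannian n M) (hM : compact_connected_riemannian g).
Local Notation d := (rdist g).

Lemma rdist_ball x y e : 0 < e -> ball x e y = (d x y < e) :> Prop.
Proof. by move=> e0; have [_ _ ->] := hM. Qed.

Lemma rdist_ge0 x y : 0 <= d x y.
Proof.
rewrite /rdist; set E := [set _ | _].
have [->|/set0P E0] := eqVneq E set0; first by rewrite inf0.
by apply: lb_le_inf => // l; exact: piecewise_C1_ge0.
Qed.

(** Symmetry, like the triangle inequality below, is inherited from the pseudometric of [M], whose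
    balls are those of [d]; no path is reversed or concatenated. *)
Lemma rdist_sym x y : d x y = d y x.
Proof.
have le z t : d z t <= d t z.
  rewrite leNgt; apply/negP => lt.
  have e0 : 0 < d z t by exact: le_lt_trans (rdist_ge0 _ _) lt.
  have := lt; rewrite -rdist_ball// => /ball_sym.
  by rewrite rdist_ball// ltxx.
by apply/eqP; rewrite eq_le !le.
Qed.

Lemma rdist_triangle y x z : d x z <= d x y + d y z.
Proof.
apply/ler_addgt0Pr => e e0.
have b t s : ball t (d t s + e / 2) s.
  by rewrite rdist_ball ?ltrDl ?divr_gt0// ltr_wpDl ?rdist_ge0 ?divr_gt0.
have := ball_triangle (b x y) (b y z).
rewrite rdist_ball; last by have := rdist_ge0 x y; have := rdist_ge0 y z; lra.
by move=> /ltW /le_trans; apply; rewrite addrACA -splitr.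
Qed.

Lemma rdistxx x : d x x = 0.
Proof.
apply/eqP; rewrite eq_le rdist_ge0 andbT.
by apply: rdist_le_length; exact: piecewise_nil.
Qed.

(* If no path joins x to y then the infimum defining the distance is the junk
   value 0; the Hausdorff property rules this case out in [rdist_path]. *)
Lemma rdist0_eq x y : d x y <= 0 -> x = y.
Proof.
move=> d0; have [hH _ _] := hM; apply/eqP/negPn/negP => xy.
move: hH; rewrite ball_hausdorff => /(_ x y xy)[[r s] /= /eqP rs].
have : (ball x r%:num `&` ball y s%:num) y.
  by split; [rewrite rdist_ball// (le_lt_trans d0)|exact: ballxx].
by rewrite rs.
Qed.

Lemma rdist_path x y e : d x y < e ->
  exists2 l, piecewise_C1 g x y l & l < e.
Proof.
move=> xye; have [/eqP E0|/set0P E0] := boolP ([set l | piecewise_C1 g x y l] == set0).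
  have dxy : d x y = 0 by rewrite /rdist E0 inf0.
  move: xye; rewrite dxy => e0; exists 0 => //.
  by rewrite (@rdist0_eq x y) ?dxy//; exact: piecewise_nil.
exact: inf_lt.
Qed.

Lemma open_rdist_lt x e : open [set y | d x y < e].
Proof.
rewrite openE => y /= xy; apply/nbhs_ballP; exists (e - d x y) => /=.
  by rewrite subr_gt0.
move=> z; rewrite rdist_ball ?subr_gt0// => yz.
by rewrite /= (le_lt_trans (rdist_triangle y x z))// -ltrBrDl.
Qed.

Lemma closed_rdist_le x e : closed [set y | d x y <= e].
Proof.
rewrite -openC openE => y /= /negP; rewrite -ltNge => xy.
apply/nbhs_ballP; exists (d x y - e) => /=; first by rewrite subr_gt0.
move=> z; rewrite rdist_ball ?subr_gt0// => yz; apply/negP; rewrite -ltNge.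
have := rdist_triangle z x y; rewrite (rdist_sym z y); lra.
Qed.

(** * Lifting of curves and paths through a local inverse *)

Section lifting.
Variables (U : set M) (f phi : M -> M) (kap : R).
Hypotheses (oU : open U) (cf : continuous f) (ofU : open (f @` U)).
Hypotheses (phiK : forall x, U x -> phi (f x) = x).
Hypothesis C1phi : C1_on g (f @` U) phi.
Hypothesis kap01 : 0 <= kap <= 1.
Hypothesis kapP : forall x u, (f @` U) x ->
  tnorm g (phi x) (u *m differential g phi x) <= kap * tnorm g x u.

(** A continuity argument. With L < r < rho, the closed ball [K] of radius r lies in [U] and is
    compact, so [f @] K[is closed. If]c[left it, let T be the infimum of the times when it is
    outside. By closedness]c T[is still inside, and the length estimate puts its lift within kap * L
    < r of]p[, hence in the open ball]O[. As]f @[O] is open, [c] stays inside a little longer, a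
    contradiction. *)
Lemma curve_lift p rho c : [set q | d p q < rho] `<=` U ->
  C1_curve g c -> U p -> f p = c 0 -> curve_length g c < rho ->
  exists p', [/\ U p', f p' = c 1 & d p p' <= kap * curve_length g c].
Proof.
move=> pU cC Up fp Lrho; set L := curve_length g c in Lrho *.
have [kap0 kap1] := andP kap01.
have L0 : 0 <= L by exact: curve_length_ge0.
have kL : kap * L <= L by rewrite ler_piMl.
pose r := (L + rho) / 2.
have [Lr rrho] : L < r /\ r < rho by rewrite /r; split; lra.
pose K := [set q | d p q <= r].
have KU : K `<=` U by move=> q Kq; apply: pU; exact: le_lt_trans rrho.
have [hH [cM _] _] := hM.
have cK : compact K by apply: subclosed_compact cM _; [exact: closed_rdist_le|].
have clfK : closed (f @` K).
  apply: compact_closed => //; apply: continuous_compact => //.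
  exact: continuous_subspaceT.
pose O := [set q | d p q < r].
have OU : O `<=` U by move=> q Oq; apply: KU; exact: ltW.
have ofO : open (f @` O).
  have -> : f @` O = f @` U `&` phi @^-1` O.
    apply/seteqP; split=> [_ [q Oq <-]|_ [[q Uq <-]]] /=.
      by split; [exists q => //; exact: OU|rewrite phiK//; exact: OU].
    by rewrite phiK// => Oq; exists q.
  by apply: open_preimage_on; [| exact: C1phi.1|exact: open_rdist_lt].
have est T : 0 <= T <= 1 -> (forall t, 0 <= t <= T -> (f @` K) (c t)) ->
    exists q, [/\ U q, f q = c T & d p q <= kap * L].
  move=> T01 cT; have [q Kq fq] : (f @` K) (c T).
    by apply: cT; case/andP: T01 => ->; rewrite lexx.
  exists q; split => //; first exact: KU.
  rewrite -(phiK Up) -(phiK (KU _ Kq)) fp fq.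
  apply: (rdist_image_curve ofU C1phi kap0) => // t /cT[z Kz <-].
  by exists z => //; exact: KU.
suff cK1 t : 0 <= t <= 1 -> (f @` K) (c t).
  by have [|//|q ?] := est 1; [rewrite ler01 lexx|exists q].
move=> t01; apply: contrapT => nKt.
pose A := [set t | 0 <= t <= 1 /\ ~ (f @` K) (c t)].
have At : A t by [].
have lA : has_lbound A by exists 0 => s [/andP[]].
pose T := inf A.
have T0 : 0 <= T by apply: lb_le_inf; [exists t|move=> s [/andP[]]].
have T1 : T <= 1 by apply: (le_trans (ge_inf lA At)); case/andP: t01.
have before s : 0 <= s < T -> (f @` K) (c s).
  move=> /andP[s0 sT]; apply: contrapT => nK.
  suff /(ge_inf lA) : A s by rewrite leNgt sT.
  by split => //; rewrite s0 (le_trans (ltW sT)).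
have atT : (f @` K) (c T).
  have [T00|T0' ] := eqVneq T 0.
    rewrite T00 -fp; exists p => //.
    by rewrite /K /= rdistxx (le_trans L0)// ltW.
  have {}T0' : 0 < T by rewrite lt_def T0'.
  apply: contrapT => nK.
  have : \forall s \near T, ~ (f @` K) (c s).
    by apply: (cC.1 T (~` (f @` K))); apply: open_nbhs_nbhs; split => //; exact: closed_openC.
  move=> /nbhs_ballP[e /= e0 eP].
  (* A time before T, within e of T and not negative. *)
  pose s := Num.max 0 (T - e / 2).
  apply: (eP s).
    rewrite /ball /= ger0_norm; last by rewrite subr_ge0 ge_max T0 gerBl divr_ge0// ltW.
    rewrite ltrBlDr -ltrBlDl lt_max; apply/orP; right; lra.
  apply: before; rewrite le_max lexx /= gt_max T0'/=; lra.
have upto s : 0 <= s <= T -> (f @` K) (c s).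
  move=> /andP[s0]; rewrite le_eqVlt => /predU1P[->//|sT].
  by apply: before; rewrite s0.
have [|q [Uq fq dq]] := est T _ upto; first by rewrite T0.
have Oq : O q by exact: le_lt_trans (le_trans dq kL) Lr.
have : \forall s \near T, (f @` O) (c s).
  apply: (cC.1 T (f @` O)); apply: open_nbhs_nbhs; split => //.
  by rewrite -fq; exists q.
move=> /nbhs_ballP[e /= e0 eP].
have [a [a01 nKa] aTe] : exists2 a, A a & a < T + e.
  by apply: inf_adherent => //; split => //; exists t.
have Ta : T <= a by exact: (ge_inf lA).
apply: nKa; have [z Oz <-] : (f @` O) (c a).
  by apply: eP; rewrite /ball /= ler0_norm ?subr_le0// opprB ltrBlDl.
by exists z => //; exact: ltW.
Qed.

(** After the first piece the lift has moved by at most the length of that piece, so the ball of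
    radius rho minus this length around the new point still lies in [U]; the remaining path is
    shorter than that. *)
Lemma path_lift x y l : piecewise_C1 g x y l ->
  forall p rho, [set q | d p q < rho] `<=` U -> U p -> f p = x -> l < rho ->
  exists p', [/\ U p', f p' = y & d p p' <= kap * l].
Proof.
have [kap0 kap1] := andP kap01.
elim=> [z p rho _ Up fp _|c z m cC pm IH p rho pU Up fp lrho].
  by exists p; rewrite rdistxx mulr0.
have L0 : 0 <= curve_length g c by exact: curve_length_ge0.
have m0 := piecewise_C1_ge0 pm.
have [|p1 [Up1 fp1 d1]] := curve_lift pU cC Up fp; first lra.
have kL : kap * curve_length g c <= curve_length g c by rewrite ler_piMl.
have [||||p2 [Up2 fp2 d2]] := IH p1 (rho - curve_length g c) => //; last first.
- exists p2; split => //; rewrite mulrDr.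
  by rewrite (le_trans (rdist_triangle p1 _ _))// lerD.
- by lra.
- move=> q /= dq; apply: pU => /=.
  have := rdist_triangle p1 p q; lra.
Qed.

(** Paths of length below e give a lift of [y] within kap * e. As [f] is injective on [U], the lift
    does not depend on e, which may then decrease to the distance. *)
Lemma rdist_lift p rho y : [set q | d p q < rho] `<=` U -> U p ->
  d (f p) y < rho ->
  exists p', [/\ U p', f p' = y & d p p' <= kap * d (f p) y].
Proof.
move=> pU Up dy; have [kap0 kap1] := andP kap01.
have lft e : d (f p) y < e -> e <= rho ->
    exists p', [/\ U p', f p' = y & d p p' <= kap * e].
  move=> /rdist_path[l pl le] er.
  have [p' [Up' fp' dp']] := path_lift pl pU Up erefl (lt_le_trans le er).
  by exists p'; split => //; rewrite (le_trans dp')// ler_wpM2l// ltW.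
have [p' [Up' fp' _]] := lft _ dy (lexx _).
exists p'; split => //; apply/ler_addgt0Pr => e e0.
(* The minimum keeps the length of the path below rho, as required for lifting. *)
pose e1 := Num.min rho (d (f p) y + e).
have [||q [Uq fq dq]] := lft e1; rewrite /e1 ?ge_min ?lexx// ?lt_min ?dy ?ltrDl//.
have <- : q = p' by rewrite -(phiK Uq) -(phiK Up') fq fp'.
apply: (le_trans dq).
apply: (@le_trans _ _ (kap * (d (f p) y + e))).
  by rewrite ler_wpM2l// ge_min lexx orbT.
by rewrite mulrDr lerD2l ler_piMl// ltW.
Qed.

End lifting.
End metric.

(** * Contraction of the inverse branches *)

Section expanding_branches.
Context {R : realType} {n : nat} {M : pseudoPMetricType R}.
Variable g : riemannian n M.

Lemma jacobian_id_comp (E F : 'rV[R]_n -> 'rV[R]_n) y :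
  differentiable E y -> differentiable F (E y) ->
  (\forall z \near y, F (E z) = z) -> 'J E y *m 'J F (E y) = 1%:M.
Proof.
move=> dE dF FE; apply/row_matrixP => i; rewrite !rowE mulmxA mulmx1.
set u := delta_mx 0 i.
rewrite -(deriveEjacobian _ dE) -(deriveEjacobian _ dF) (deriveE _ dF) (deriveE _ dE).
transitivity ('d (F \o E) y u).
  have dc := diff_comp dE dF.
  exact: (esym (congr1 (fun l : _ -> _ => l u) dc)).
rewrite -(deriveE _ (differentiable_comp dE dF)).
have FE' : \forall z \near y, (F \o E) z = id z by exact: FE.
by rewrite (near_eq_derive _ FE') derive_id.
Qed.

Lemma differential_inverse (U : set M) (f h : M -> M) x : open U ->
  open (f @` U) -> C1_on g U f -> C1_on g (f @` U) h ->
  (forall x, U x -> h (f x) = x) -> U x ->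
  differential g f x *m differential g h (f x) = 1%:M.
Proof.
move=> oU ofU C1f C1h hK Ux; rewrite /differential hK//.
have dx := dom_center g x; have dfx := dom_center g (f x).
have fx : local_expr g x (f x) f (chart g x x) = chart g (f x) (f x).
  by rewrite /local_expr /= chartK.
rewrite -[X in _ *m 'J _ X]fx; apply: jacobian_id_comp.
- by have [dE _] := C1f.2 x (f x); apply: dE; exists x.
- rewrite fx; have [dE _] := C1h.2 (f x) x; apply: dE; exists (f x) => //.
  by split; [split => //; exists x|rewrite /= hK].
have oA : open ((dom g x `&` U) `&` f @^-1` dom g (f x)).
  rewrite -setIA; apply: openI; first exact: dom_open.
  by apply: open_preimage_on => //; [exact: C1f.1|exact: dom_open].
have oA' : open (chart g x @` ((dom g x `&` U) `&` f @^-1` dom g (f x))).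
  by apply: open_chart_image => // z [[]].
apply: (filterS _ (open_nbhs_nbhs (conj oA' (imageP _ (conj (conj dx Ux) dfx))))).
by move=> _ [z [[dz Uz] dfz] <-]; rewrite /local_expr /= !chartK// hK.
Qed.

(* [opnorm] is a supremum, with a junk value for unbounded sets; conformality
   yields the bound `|a|^-1 that makes it meaningful. *)
Lemma conformal_inverse_norm x y (D1 D2 I : 'M[R]_n) (a s : R) :
  D1 *m D2 = 1%:M -> D1 = a *: I ->
  (forall u, tnorm g y (u *m I) = tnorm g x u) ->
  opnorm g y x D2 < s ->
  0 <= s /\ forall u, tnorm g x (u *m D2) <= s * tnorm g y u.
Proof.
move=> D12 D1E Iiso lts; have D21 := mulmx1C D12.
have key v : `|a| * tnorm g x (v *m D2) = tnorm g y v.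
  by rewrite -Iiso -tnormZ scalemxAr -D1E -mulmxA D21 mulmx1.
have t0 z : tnorm g z 0 = 0 by rewrite -(scale0r 0) tnormZ normr0 mul0r.
have bnd v : tnorm g x (v *m D2) <= `|a|^-1 * tnorm g y v.
  (* For a = 0 the invertible matrix [D1] would vanish, which leaves only the zero vector. *)
  rewrite -key; have [a0|a0] := eqVneq a 0; last first.
    by rewrite mulrA mulVf ?mul1r// normr_eq0.
  have u0 : v = 0.
    by rewrite -[v]mulmx1 -D12 D1E a0 scale0r mul0mx mulmx0.
  by rewrite u0 mul0mx t0 !mulr0.
pose E := [set tnorm g x (u *m D2) | u in [set u | tnorm g y u <= 1]].
have hE : has_ubound E.
  exists `|a|^-1 => _ [u u1 <-]; apply: (le_trans (bnd u)).
  by rewrite ler_piMr.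
have s0 : 0 <= s.
  apply: ltW; apply: le_lt_trans lts; apply: (ub_le_sup hE).
  by exists 0; rewrite /= ?mul0mx t0 ?ler01.
split => // u; have [u0|u0] := eqVneq (tnorm g y u) 0.
  by apply: (le_trans (bnd u)); rewrite u0 !mulr0.
have u1 : 0 < tnorm g y u by rewrite lt_def u0 tnorm_ge0.
have : tnorm g x (((tnorm g y u)^-1 *: u) *m D2) <= s.
  apply: ltW; apply: le_lt_trans lts; apply: (ub_le_sup hE).
  exists ((tnorm g y u)^-1 *: u) => //=.
  by rewrite tnormZ ger0_norm ?invr_ge0 ?tnorm_ge0// mulVf.
rewrite -scalemxAl tnormZ ger0_norm ?invr_ge0 ?tnorm_ge0//.
by rewrite mulrC ler_pdivrMr.
Qed.

Variables (hM : compact_connected_riemannian g).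
Variables (k : nat) (f : 'I_k.+1 -> M -> M) (ce : conformal_expanding g f).
Hypothesis C1f : forall i, C1_on g setT (f i).
Local Notation d := (rdist g).
Local Notation U i := (rneighborhood (exp_r ce) (Vball ce i)).

Lemma letter_continuous i : continuous (f i).
Proof. by move=> x; exact: (C1f i).1. Qed.

Lemma letter_domain_sub i p q : Vball ce i p -> d p q < exp_r ce -> U i q.
Proof. by move=> Vp pq; exists p => //; rewrite (rdist_ball hM)//; exact: rr_gt0. Qed.

Lemma open_letter_domain i : open (U i).
Proof.
rewrite openE => y [x Vx xy].
move: xy; rewrite (rdist_ball hM)// => [xy|]; last exact: rr_gt0.
apply: (filterS _ (open_nbhs_nbhs (conj (open_rdist_lt hM x (exp_r ce)) xy))).
by move=> z xz; exact: letter_domain_sub Vx xz.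
Qed.

Lemma letter_inverse i : exists h : M -> M,
  [/\ forall x, U i x -> h (f i x) = x, C1_on g (f i @` U i) h,
      0 <= exp_sigma ce &
      forall x u, (f i @` U i) x ->
        tnorm g (h x) (u *m differential g h x) <= exp_sigma ce * tnorm g x u].
Proof.
have [_ ofU C1 [h hK C1h]] := V_diffeo ce i.
have bnd x : U i x -> 0 <= exp_sigma ce /\ forall u,
    tnorm g x (u *m differential g h (f i x)) <=
    exp_sigma ce * tnorm g (f i x) u.
  move=> Ux; have [a [I [DE Iiso]]] := V_conformal Ux.
  have D12 := differential_inverse (open_letter_domain i) ofU C1 C1h hK Ux.
  apply: (conformal_inverse_norm D12 DE Iiso).
  (* The expansion hypothesis is about [invmx], which is the differential of [h] since [D12] makes
     the latter a right inverse. *)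
  have [uD _] := mulmx1_unit D12.
  have := V_expanding Ux; congr (opnorm _ _ _ _ < _).
  by rewrite -[RHS]mul1mx -(mulVmx uD) -mulmxA D12 mulmx1.
exists h; split => //.
(* The sign of [exp_sigma] is read off from an operator norm at some point of the domain; the centre
   of the ball is one. *)
- have Uc : U i (vcenter ce i).
    apply: (@letter_domain_sub _ (vcenter ce i)); last by rewrite rdistxx rr_gt0.
    by apply: ballxx; exact: vradius_gt0.
  exact: (bnd _ Uc).1.
- by move=> _ u [x Ux <-]; rewrite (hK _ Ux); exact: (bnd x Ux).2.
Qed.

Lemma exp_sigma_ge0 : 0 <= exp_sigma ce.
Proof. by have [h []] := letter_inverse ord0. Qed.

Lemma letter_lift i p rho y : [set q | d p q < rho] `<=` U i -> U i p ->
  d (f i p) y < rho ->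
  exists p', [/\ U i p', f i p' = y & d p p' <= exp_sigma ce * d (f i p) y].
Proof.
have [h [hK C1h s0 hP]] := letter_inverse i.
have [_ ofU _ _] := V_diffeo ce i.
apply: (rdist_lift hM _ _ hK C1h) => //.
- exact: letter_continuous.
- by rewrite s0 ltW// sigma_lt1.
Qed.

Lemma letter_inj i x y : U i x -> U i y -> f i x = f i y -> x = y.
Proof.
by move=> Ux Uy; have [finj _ _ _] := V_diffeo ce i; apply: finj; rewrite inE.
Qed.

(** Separates the condition on the domains, under which [fword f w] is injective, from the condition
    on the endpoint. *)
Lemma inverse_branchE w B :
  inverse_branch ce w B = inverse_branch ce w setT `&` fword f w @^-1` B.
Proof.
elim: w => [|i w IH] /=; first by rewrite setTI.
by rewrite IH preimage_setI setIA.
Qed.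

Lemma open_inverse_branch w B : open B -> open (inverse_branch ce w B).
Proof.
elim: w => [|i w IH] //= oB; apply: openI; first exact: open_letter_domain.
by apply: open_comp; [move=> x _; exact: letter_continuous|exact: IH].
Qed.

Lemma inverse_branch_inj w x y : inverse_branch ce w setT x ->
  inverse_branch ce w setT y -> fword f w x = fword f w y -> x = y.
Proof.
elim: w x y => [|i w IH] x y //= [Ux bx] [Uy b_y] xy.
exact: (letter_inj Ux Uy (IH _ _ bx b_y xy)).
Qed.

(** The target is pulled back from the last letter to the first. Each lift does not increase the
    distance to the orbit of [q], which stays below s < r, hence inside the domains of the
    letters. *)
Lemma branch_exists w q s y : admissible_rec ce w q -> s < exp_r ce ->
  d (fword f w q) y < s ->
  exists x, [/\ inverse_branch ce w setT x, fword f w x = y & d q x < s].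
Proof.
elim: w q => [|i w IH] q /=; first by move=> _ _ qy; exists y.
move=> [Vq adm] sr qy; have [x1 [b1 fx1 qx1]] := IH _ adm sr qy.
have sub : [set z | d q z < exp_r ce] `<=` U i.
  by move=> z; exact: letter_domain_sub.
have Uq : U i q by apply: sub; rewrite /= rdistxx rr_gt0.
have [x [Ux fx dx]] := letter_lift sub Uq (lt_trans qx1 sr).
exists x; rewrite fx; split => //.
apply: (le_lt_trans dx); apply: le_lt_trans qx1.
by rewrite ler_piMl ?(rdist_ge0 g)// ltW// sigma_lt1.
Qed.

(** The orbit of [x] follows that of [q] within s < r / 2, so at each letter the ball of radius r /
    2 around it lies in the domain of expansion, and the orbit of [x'] is its lift there. One factor
    [exp_sigma] is kept, which is why the word must be nonempty. *)
Lemma branch_contraction w q s x x' : admissible ce w q -> s < exp_r ce / 2 ->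
  inverse_branch ce w setT x -> inverse_branch ce w setT x' ->
  d (fword f w q) (fword f w x) < s ->
  d (fword f w x) (fword f w x') < exp_r ce / 2 ->
  d x x' <= exp_sigma ce * d (fword f w x) (fword f w x').
Proof.
have r0 := rr_gt0 ce; have s1 := sigma_lt1 ce; have s0 := exp_sigma_ge0.
move=> [w0 adm] sr; elim: w q x x' w0 adm => [//|i w IH] q x x' _ /= [Vq adm].
move=> [Ux b_x] [Ux' b_x'] qx xx'.
have sr' : s < exp_r ce by lra.
have [x1 [b1 fx1 qx1]] := branch_exists adm sr' qx.
have x1E : x1 = f i x by exact: inverse_branch_inj b1 b_x fx1.
have dqx : d q x < s.
  have adm' : admissible_rec ce (i :: w) q by [].
  have [z [bz fz qz]] := branch_exists adm' sr' qx.
  by have <- : z = x by exact: inverse_branch_inj bz (conj Ux b_x) fz.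
(* An empty remainder gives equality; otherwise the factor of the induction hypothesis is bounded by
   1. *)
have le1 : d (f i x) (f i x') <= d (fword f w (f i x)) (fword f w (f i x')).
  case: w IH adm b_x b_x' qx xx' b1 fx1 => [//|j w] IH adm b_x b_x' qx xx' _ _.
  apply: (le_trans (IH (f i q) _ _ isT adm b_x b_x' qx xx')).
  by rewrite ler_piMl ?(rdist_ge0 g)// ltW.
have sub : [set z | d x z < exp_r ce / 2] `<=` U i.
  move=> z /= xz; apply: (letter_domain_sub Vq).
  have := rdist_triangle hM x q z; lra.
have [x'' [Ux'' fx'' dx'']] := letter_lift sub Ux (le_lt_trans le1 xx').
have x''E := letter_inj Ux'' Ux' fx''.
rewrite x''E in dx''.
by rewrite (le_trans dx'')// ler_wpM2l.
Qed.

End expanding_branches.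

(** * Existence of a periodic orbit *)

Section periodic_orbit.
Context {R : realType} {n : nat} {M : pseudoPMetricType R}.
Variables (g : riemannian n M) (hM : compact_connected_riemannian g).
Local Notation d := (rdist g).

Lemma geometric_le0 (a b s : R) : 0 <= s < 1 ->
  (forall m, a <= b * s ^+ m) -> a <= 0.
Proof.
move=> /andP[s0 s1] ab.
have cs : b * s ^+ m @[m --> \oo] --> b * 0.
  by apply: cvgM; [exact: cvg_cst|apply: cvg_expr; rewrite ger0_norm].
rewrite -(mulr0 b) -(cvg_lim _ cs)//.
by apply: limr_ge; [apply/cvg_ex; exists (b * 0)|exact: nearW].
Qed.

(** Banach's argument for a cycle of contractions: iterating the simultaneous update of all
    coordinates from arbitrary points of the [K j] gives Cauchy sequences with a geometric rate.
    Compactness supplies cluster points, which the Cauchy estimate makes limits. *)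
Lemma cyclic_fixed_point (I : finType) (next : I -> I) (K : I -> set M)
    (Phi : I -> M -> M) (s : R) : 0 <= s < 1 ->
  (forall j, compact (K j)) -> (forall j, K j !=set0) ->
  (forall j x, K (next j) x -> K j (Phi j x)) ->
  (forall j x y, K (next j) x -> K (next j) y ->
    d (Phi j x) (Phi j y) <= s * d x y) ->
  exists x : I -> M, forall j, K j (x j) /\ x j = Phi j (x (next j)).
Proof.
move=> /[dup] s01 /andP[s0 s1] cK K0 KPhi ctr.
pose u m j := iter m (fun (v : I -> M) j => Phi j (v (next j)))
                (fun j => get (K j)) j.
have uK m j : K j (u m j).
  elim: m j => [|m IH] j /=; first by rewrite /u /=; apply: getPex; exact: K0.
  by apply: KPhi; exact: IH.
(* The sum bounds all first steps at once, so that the bound is the same for j and [next j]. *)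
pose C := \sum_j d (u 0 j) (u 1 j).
have step m j : d (u m j) (u m.+1 j) <= C * s ^+ m.
  elim: m j => [|m IH] j.
    rewrite expr0 mulr1 /C (bigD1 j)//= lerDl.
    by apply: sumr_ge0 => i _; exact: rdist_ge0.
  apply: (le_trans (ctr _ _ _ (uK m _) (uK m.+1 _))).
  by rewrite exprS mulrCA; apply: ler_wpM2l.
(* The sum of the geometric series; the identity C + B * s = B closes the induction on l. *)
pose B := C / (1 - s).
have BE : C + B * s = B by rewrite /B; field; rewrite subr_eq0 gt_eqF.
have cauchy l m j : d (u m j) (u (m + l)%N j) <= B * s ^+ m.
  have B0 : 0 <= B.
    apply: divr_ge0; last by rewrite subr_ge0 ltW.
    by apply: sumr_ge0 => i _; exact: rdist_ge0.
  elim: l m j => [|l IH] m j.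
    by rewrite addn0 rdistxx mulr_ge0// exprn_ge0.
  apply: (le_trans (rdist_triangle hM (u m.+1 j) _ _)).
  rewrite -addSnnS -BE mulrDl; apply: lerD; first exact: step.
  by apply: (le_trans (IH _ _)); rewrite exprS mulrA.
have lim j : exists y, K j y /\ forall m, d (u m j) y <= B * s ^+ m.
  have FK : ((fun m => u m j) @ \oo) (K j).
    by exists 0%N => // m _; exact: uK.
  have [y [Ky cy]] := cK j _ _ FK; exists y; split => // m.
  apply/ler_addgt0Pr => e e0.
  have Fm : ((fun m => u m j) @ \oo) [set u (m + l)%N j | l in setT].
    exists m => // p /= mp; exists (p - m)%N => //.
    by rewrite subnKC.
  have [_ [[l _ <-]]] := cy _ _ Fm (nbhsx_ballx y e e0).
  rewrite (rdist_ball hM)// => dy.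
  apply: (le_trans (rdist_triangle hM (u (m + l)%N j) _ _)).
  by apply: lerD; [exact: cauchy|rewrite rdist_sym// ltW].
have [x xP] := choice lim.
exists x => j; split; first exact: (xP j).1.
apply: (rdist0_eq hM); apply: (geometric_le0 (b := B * 2) s01) => m.
have h1 := (xP j).2 m.+1.
have h2 : d (Phi j (u m (next j))) (Phi j (x (next j))) <= s * (B * s ^+ m).
  apply: (le_trans (ctr _ _ _ (uK m _) (xP _).1)).
  by apply: ler_wpM2l => //; exact: (xP _).2.
have h3 := rdist_triangle hM (u m.+1 j) (x j) (Phi j (x (next j))).
rewrite (rdist_sym hM (x j) (u m.+1 j)) in h3.
have h4 : s * (B * s ^+ m) <= B * s ^+ m.
  apply: ler_piMl; last exact: ltW.
  by apply: le_trans (cauchy 0%N m j); exact: rdist_ge0.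
move: h1; rewrite exprS mulrCA => h1.
have -> : B * 2 * s ^+ m = B * s ^+ m + B * s ^+ m by ring.
apply: (le_trans h3); apply: lerD; [exact: le_trans h4|exact: le_trans h4].
Qed.

Variables (k : nat) (f : 'I_k.+1 -> M -> M) (ce : conformal_expanding g f).
Hypothesis C1f : forall i, C1_on g setT (f i).
Variables (lambda : probability (borel M) R) (S : inducing_scheme ce lambda).

(** Both balls are the image of the interior of the same partition element. This lets the branch
    data of [wd_branch] be used on the next ball of the cycle. *)
Lemma cyc_target (j : 'I_(nballs S)) : Bset (target S (cyc j)) = Bset (ordS j).
Proof. by rewrite -hmap_target cyc_image. Qed.

Lemma word_nonempty i : wd S i != [::].
Proof. by have [x [s [[]]]] := wd_branch S i. Qed.

Lemma cyclic_orbit : exists x : 'I_(nballs S) -> M, forall j,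
  ((Mi S (cyc j))°) (x j) /\ hmap S (cyc j) (x j) = x (ordS j).
Proof.
have r0 := rr_gt0 ce; have eta := eta_lt ce; have e0 := eps_gt0 S.
have e6 := eps_le S.
pose w (j : 'I_(nballs S)) := wd S (cyc j).
pose A j := inverse_branch ce (w j) (Bset (ordS j)).
have inB (j : 'I_(nballs S)) y : Bset j y -> d (bcenter j) y < eps S.
  by rewrite /Bset (rdist_ball hM).
have branch j : exists q s, [/\ admissible ce (w j) q, s < exp_r ce / 2,
    forall y, Bset (ordS j) y -> d (fword f (w j) q) y < s &
    Mi S (cyc j) = closure (A j)].
  have [q [s [adm ss sub ME]]] := wd_branch S (cyc j).
  (* s may be nonpositive, in which case balls of radius s are unspecified *)
  exists q, (Num.max s (exp_r ce / 4)); split => //.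
  - by rewrite gt_max; apply/andP; split; lra.
  - move=> y; rewrite -cyc_target => /sub yq.
    rewrite -(rdist_ball hM); last by rewrite lt_max; apply/orP; right; lra.
    by apply: le_ball yq; rewrite le_max lexx.
  - by rewrite ME cyc_target.
have AM j : A j `<=` (Mi S (cyc j))°.
  have [q [s [_ _ _ ->]]] := branch j.
  rewrite -open_subsetE; first exact: subset_closure.
  apply: open_inverse_branch => //.
  rewrite (_ : Bset (ordS j) = [set y | d (bcenter (ordS j)) y < eps S]).
    exact: open_rdist_lt.
  by apply/seteqP; split => y; rewrite /Bset /= (rdist_ball hM).
(* Choice is applied to pairs, so that one function gives all the branches; its values off the balls
   are irrelevant. *)
have sel (p : 'I_(nballs S) * M) : exists x, Bset (ordS p.1) p.2 ->
    inverse_branch ce (w p.1) setT x /\ fword f (w p.1) x = p.2.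
  have [By|nB] := pselect (Bset (ordS p.1) p.2); last by exists p.2.
  have [q [s [[_ adm] ss qy _]]] := branch p.1.
  have sr : s < exp_r ce by lra.
  have [x [bx fx _]] := branch_exists hM C1f adm sr (qy _ By).
  by exists x.
have [Phi PhiP] := choice sel.
have PhiA j y : Bset (ordS j) y -> A j (Phi (j, y)).
  move=> By; have [bx fx] := PhiP (j, y) By.
  by rewrite /A inverse_branchE; split => //=; rewrite fx.
have KB (j : 'I_(nballs S)) : Mi S (cyc j) `<=` Bset j by move=> y; exact: cyc_sub.
have PhiK j y : Bset (ordS j) y -> Mi S (cyc j) (Phi (j, y)).
  by move=> By; apply: interior_subset; apply: AM; exact: PhiA.
have s01 : 0 <= exp_sigma ce < 1 by rewrite (exp_sigma_ge0 hM ce) sigma_lt1.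
have [||||x xP] := @cyclic_fixed_point _ (@ordS (nballs S))
    (fun j => Mi S (cyc j)) (fun j y => Phi (j, y)) _ s01.
- move=> j; have [_ [cM _] _] := hM; apply: subclosed_compact cM _ => //.
  by have [q [s [_ _ _ ->]]] := branch j; exact: closed_closure.
- move=> j; exists (Phi (j, bcenter (ordS j))).
  by apply: PhiK; apply: ballxx.
- by move=> j y Ky; apply: PhiK; exact: KB.
- move=> j y z /KB By /KB Bz.
  have [q [s [adm ss qs _]]] := branch j.
  have [b1 f1] := PhiP (j, y) By; have [b2 f2] := PhiP (j, z) Bz.
  have := branch_contraction hM C1f adm ss b1 b2.
  rewrite /= f1 f2; apply; first exact: qs.
  (* Two points of this ball are less than 2 * eps apart, and 2 * eps <= eta / 3 < r / 6. *)
  have := inB _ _ By; have := inB _ _ Bz => h1 h2.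
  have := rdist_triangle hM (bcenter (ordS j)) y z.
  rewrite (rdist_sym hM y (bcenter _)); lra.
exists x => j; have [_ xE] := xP j.
have Bx : Bset (ordS j) (x (ordS j)) by apply: KB; exact: (xP _).1.
(* The fixed point is known to lie in the closed set only; being a value of the branch puts it in
   the interior. *)
split; rewrite xE; first by apply: AM; exact: PhiA.
exact: (PhiP (j, _) Bx).2.
Qed.

End periodic_orbit.

(** * Symbolic coding of the periodic orbit *)

Lemma ordS_ind N (P : 'I_N -> Prop) j0 : P j0 ->
  (forall j, P j -> P (ordS j)) -> forall j, P j.
Proof.
move=> P0 PS j.
(* The number of steps is congruent to j - j0 modulo N and is not truncated by the subtraction. *)
pose m := (j + (N - j0))%N.
have it p : iter p (@ordS N) j0 = ((j0 + p) %% N)%N :> nat.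
  elim: p => [|p IH]; first by rewrite addn0 modn_small.
  by rewrite iterS /= IH -[X in (X %% _)%N]addn1 modnDml -addnA addn1.
have -> : j = iter m (@ordS N) j0.
  apply: val_inj; rewrite /= it /m addnCA subnKC; last exact: ltnW.
  by rewrite modnDr modn_small.
by elim: m => //= p IH; exact: PS.
Qed.

(** * Concatenation of nonempty words *)

Section concatenation.
Context {A : Type} (a0 : A).
Implicit Types W : nat -> seq A.

Definition concat_prefix W L := flatten [seq W j | j <- iota 0 L].

Definition concat_letter W m := nth a0 (concat_prefix W m.+1) m.

Lemma concat_prefixS W L :
  concat_prefix W L.+1 = W 0%N ++ concat_prefix (W \o S) L.
Proof.
rewrite /concat_prefix /=; congr (_ ++ flatten _).
by rewrite -[1%N]addn0 iotaDl -map_comp.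
Qed.

Lemma size_concat_prefix W L : (forall j, (0 < size (W j))%N) ->
  (L <= size (concat_prefix W L))%N.
Proof.
elim: L W => [//|L IH] W W0; rewrite concat_prefixS size_cat -add1n.
by apply: leq_add; [exact: W0|apply: IH => j; exact: W0].
Qed.

(** Since m + 1 nonempty blocks have at least m + 1 letters, further blocks do not affect the letter
    at position m. *)
Lemma nth_concat_prefix W L m : (forall j, (0 < size (W j))%N) -> (m < L)%N ->
  nth a0 (concat_prefix W L) m = concat_letter W m.
Proof.
move=> W0 mL; rewrite /concat_letter /concat_prefix -(subnKC mL) iotaD map_cat.
by rewrite flatten_cat nth_cat (leq_trans _ (size_concat_prefix m.+1 W0)).
Qed.

Lemma concat_letter_cons W m : (forall j, (0 < size (W j))%N) ->
  concat_letter W m = if (m < size (W 0%N))%N then nth a0 (W 0%N) m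
    else concat_letter (W \o S) (m - size (W 0%N)).
Proof.
move=> W0; rewrite {1}/concat_letter concat_prefixS nth_cat.
case: ltnP => // Wm; rewrite nth_concat_prefix//.
  by move=> j; exact: W0.
by rewrite ltn_subrL W0 (leq_trans _ Wm)// W0.
Qed.

End concatenation.

Section coding.
Context {R : realType} {n : nat} {M : pseudoPMetricType R}.
Variables (g : riemannian n M) (k : nat) (f : 'I_k.+1 -> M -> M).

Lemma fword_cat u v x : fword f (u ++ v) x = fword f v (fword f u x).
Proof. by elim: u x => //= i u IH x. Qed.

Lemma shiftn0 (s : fullshift k) : shiftn 0 s = s.
Proof. by apply/funext => l; rewrite /shiftn addr0. Qed.

Lemma iter_FA l (z : skew_space k M) :
  iter l (FA f) z = (shiftn l z.1, fseq f z.1 l z.2).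
Proof.
elim: l => [|l IH]; first by rewrite shiftn0; case: z.
rewrite iterS IH /FA /=; congr pair.
  by apply/funext => p; rewrite /shiftn -addrA -PoszD add1n.
rewrite /fseq /mkseq -[l.+1]addn1 iotaD map_cat fword_cat /=.
by rewrite /shiftn add0r.
Qed.

Variables (ce : conformal_expanding g f).
Variables (lambda : probability (borel M) R) (S : inducing_scheme ce lambda).

Lemma SigmaA_shiftn m s : SigmaA ce s -> SigmaA ce (shiftn m s).
Proof. by move=> sA l; rewrite /shiftn addrAC; exact: sA. Qed.

Lemma size_wd_gt0 i : (0 < size (wd S i))%N.
Proof. by rewrite lt0n size_eq0 word_nonempty. Qed.

Lemma rho_pos s m :
  rho S s (Posz m) = concat_letter ord0 (fun j => wd S (s (Posz j))) m.
Proof. by []. Qed.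

(** Read leftwards, the left half is the concatenation of the reversed words, so that both halves
    fall under [concat_letter]. *)
Lemma rho_neg s m :
  rho S s (Negz m) = concat_letter ord0 (fun j => rev (wd S (s (Negz j)))) m.
Proof.
rewrite /rho rev_flatten -map_comp -map_rev revK.
by congr (nth _ (flatten _) _).
Qed.

(** Shifting by the length of the zeroth word moves the origin to the start of the next one; hence
    the induced map acts on codes as the shift on itineraries. *)
Lemma rho_shift s :
  shiftn (size (wd S (s 0))) (rho S s) = rho S (fun l => s (l + 1)).
Proof.
have p0 s' j : (0 < size (wd S (s' (Posz j))))%N by exact: size_wd_gt0.
have n0 s' j : (0 < size (rev (wd S (s' (Negz j)))))%N.
  by rewrite size_rev size_wd_gt0.
apply/funext => -[m|m]; rewrite /shiftn.
  rewrite -PoszD !rho_pos concat_letter_cons; last exact: p0.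
  rewrite ltnNge leq_addl /= addnK; congr (concat_letter _ _ _).
  by apply/funext => j /=; rewrite -(addn1 j).
rewrite [RHS]rho_neg concat_letter_cons; last exact: (n0 (fun l => s (l + 1))).
(* A negative position of the shifted code falls in the word that has just been passed when m is
   below its length, and further left otherwise. *)
rewrite size_rev; case: ltnP => [mT|Tm].
  have -> : Negz m + size (wd S (s 0)) = Posz (size (wd S (s 0)) - m.+1).
    by rewrite NegzE addrC -subzn.
  rewrite rho_pos concat_letter_cons; last exact: p0.
  by rewrite ltn_subrL /= size_wd_gt0 nth_rev.
have -> : Negz m + size (wd S (s 0)) = Negz (m - size (wd S (s 0))).
  by rewrite !NegzE -subSn// -subzn 1?ltnW// opprB addrC.
rewrite rho_neg; congr (concat_letter _ _ _); apply/funext => j /=.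
have -> // : Negz j.+1 + 1 = Negz j by rewrite !NegzE; lia.
Qed.

Lemma fseq_rho s : fseq f (rho S s) (size (wd S (s 0))) = hmap S (s 0).
Proof.
rewrite /fseq /hmap; congr (fword f _).
apply: (@eq_from_nth _ ord0); rewrite size_mkseq// => i iT.
by rewrite nth_mkseq// rho_pos concat_letter_cons ?iT// => j; exact: size_wd_gt0.
Qed.

Lemma fseq_rho' s t : s 0 = t -> fseq f (rho S s) (size (wd S t)) = hmap S t.
Proof. by move=> <-; exact: fseq_rho. Qed.

Hypothesis hrho : rho_wf S.
Variable x : 'I_(nballs S) -> M.
Hypothesis xP : forall j,
  ((Mi S (cyc j))°) (x j) /\ hmap S (cyc j) (x j) = x (ordS j).

Definition cycle_index (j : 'I_(nballs S)) (l : int) : 'I_(nballs S) :=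
  match l with
  | Posz m => iter m (@ordS _) j
  | Negz m => iter m.+1 (@ord_pred _) j
  end.

Lemma cycle_indexS j l : cycle_index j (l + 1) = ordS (cycle_index j l).
Proof.
case: l => [m|[|m]]; first by rewrite -PoszD addn1.
  by rewrite /= ord_predK.
have -> : Negz m.+1 + 1 = Negz m by rewrite !NegzE; lia.
by rewrite /= ord_predK.
Qed.

Lemma cycle_index_ordS j l : cycle_index (ordS j) l = cycle_index j (l + 1).
Proof.
case: l => [m|[|m]]; first by rewrite -PoszD addn1 /= -iterSr.
  by rewrite /= ordSK.
have -> : Negz m.+1 + 1 = Negz m by rewrite !NegzE; lia.
by rewrite /cycle_index iterSr ordSK.
Qed.

Definition cycle_itinerary j (l : int) : nat := cyc (cycle_index j l).

Lemma cycle_itinerary_admissible j : SigmaInd S (cycle_itinerary j).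
Proof.
move=> l; exists (x (cycle_index j l)); split; first exact: (xP _).1.
by rewrite /= (xP _).2 /cycle_itinerary cycle_indexS; exact: (xP _).1.
Qed.

Definition cycle_point j : skew_space k M := (rho S (cycle_itinerary j), x j).
Local Notation z := cycle_point.

(** Injectivity of [rho] recovers the itinerary from the code, and with it the digit at 0. *)
Lemma cycle_point_rho j i : (rho S @` cylinder S i) (z j).1 <-> i = cyc j.
Proof.
split=> [[s [sI <-]] sE|->]; last first.
  by exists (cycle_itinerary j) => //; split => //; exact: cycle_itinerary_admissible.
by rewrite (hrho.2 _ _ sI (cycle_itinerary_admissible j) sE).
Qed.

Lemma cycle_point_digit0 j : digit0 S (z j).1 = cyc j.
Proof.
apply/cycle_point_rho.
apply: (@getPex _ [set i | (rho S @` cylinder S i) (z j).1]).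
by exists (cyc j); exact/cycle_point_rho.
Qed.

Lemma cycle_point_block j i : block S i (z j) <-> i = cyc j.
Proof.
split=> [[/cycle_point_rho]//|->]; split; first exact/cycle_point_rho.
by apply: interior_subset; exact: (xP j).1.
Qed.

Lemma cycle_point_WW j : WW S (z j).
Proof. by exists (cyc j) => //; exact/cycle_point_block. Qed.

(** [get] returns some index whose interior contains [x j]; the interiors being disjoint, it is
    [cyc j]. *)
Lemma tau_cycle j : tau S (x j) = size (wd S (cyc j)).
Proof.
rewrite /tau asboolT; last by exists (cyc j); exact: (xP j).1.
set E := [set i | _].
have Eg : E (get E) by apply: getPex; exists (cyc j); exact: (xP j).1.
have [_ _ _ disj _] := Mi_markov S.
have [-> //|/eqP ne] := eqVneq (get E) (cyc j).
have : ((Mi S (get E))° `&` (Mi S (cyc j))°) (x j) by split => //; exact: (xP j).1.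
by rewrite disj.
Qed.

Lemma psi_cycle j : psi S (z j) = size (wd S (cyc j)).
Proof.
by rewrite /psi cycle_point_digit0 asboolT ?tau_cycle//; exact: (xP j).1.
Qed.

Lemma FApsi_cycle j : FApsi S (z j) = z (ordS j).
Proof.
rewrite /FApsi cycle_point_digit0 asboolT; last exact: (xP j).1.
rewrite tau_cycle (@fseq_rho' (cycle_itinerary j) (cyc j))// (xP j).2.
congr pair; rewrite -[size _]/(size (wd S (cycle_itinerary j 0))) rho_shift.
by congr rho; apply/funext => l; rewrite /cycle_itinerary cycle_index_ordS.
Qed.

Lemma iter_FA_cycle j :
  iter (size (wd S (cyc j))) (FA f) (z j) = z (ordS j).
Proof.
rewrite iter_FA -FApsi_cycle /FApsi cycle_point_digit0 asboolT ?tau_cycle//.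
exact: (xP j).1.
Qed.

Lemma SigmaAM_cycle j l : SigmaAM ce (iter l (FA f) (z j)).
Proof.
rewrite iter_FA; split => //; apply: SigmaA_shiftn.
exact: hrho.1 (cycle_itinerary_admissible j).
Qed.

Lemma YY_cycle j l : (l < size (wd S (cyc j)))%N -> YY S (iter l (FA f) (z j)).
Proof.
by move=> lT; exists (z j), l; split; [exact: cycle_point_WW|rewrite psi_cycle|].
Qed.

End coding.

(** * Measures on finitely many points *)

Import HBNNSimple.

Section point_masses.
Context {d : measure_display} {T : measurableType d} {R : realType}.
Implicit Types (a : T) (s : seq T) (U : set T).

Definition point_sum a s : set T -> \bar R :=
  msum (fun i => @dirac _ T (nth a s i) R) (size s).

HB.instance Definition _ a s := Measure.on (point_sum a s).

Lemma point_sumE a s U : point_sum a s U = (\sum_(y <- s) \1_U y)%:E.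
Proof. by rewrite /point_sum /msum (big_nth a) big_mkord sumEFin. Qed.

Definition point_mean a s : set T -> \bar R :=
  mscale ((size s).+1%:R^-1)%:nng (point_sum a (a :: s)).

HB.instance Definition _ a s := Measure.on (point_mean a s).

Lemma point_meanE a s U : point_mean a s U =
  ((size s).+1%:R^-1 * \sum_(y <- a :: s) \1_U y)%:E.
Proof. have e : point_sum a (a :: s) U = (\sum_(y <- a :: s) \1_U y)%:E := point_sumE _ _ _.
by rewrite EFinM -e. Qed.

Lemma point_mean_setT a s : point_mean a s setT = 1%E.
Proof.
rewrite point_meanE; congr EFin.
by rewrite indicT big_const_seq count_predT iter_addr_0 mulVf ?pnatr_eq0.
Qed.

HB.instance Definition _ a s :=
  Measure_isProbability.Build _ _ _ (point_mean a s) (point_mean_setT a s).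

(* No measurability of h is assumed, so that the bounds apply to psi on WW
   without having to prove that WW is Borel. *)
Lemma integral_bounds_full_set (mu : {measure set T -> \bar R}) (F : set T)
    (h : T -> \bar R) (C : R) : measurable F -> mu F = 1%E -> mu (~` F) = 0%E ->
  (forall x, 0 <= h x)%E -> (forall x, F x -> 1 <= h x <= C%:E)%E ->
  (1 <= \int[mu]_x h x <= C%:E)%E.
Proof.
(* The integral is the supremum over simple functions below [h]. The indicator of [F] is one of
   them, and each of them is at most [C] on [F], hence almost everywhere. *)
move=> mF F1 F0 h0 hF; rewrite ge0_integralTE//; apply/andP; split.
  apply: ereal_sup_ubound; exists (indic_nnsfun R mF).
    move=> x; rewrite -[X in X%:E]/(\1_F x) indicE; case: (boolP (x \in F)) => [xF|_].
      by have := hF x (set_mem xF) => /andP[].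
    exact: h0.
  rewrite -F1 -[in RHS](setIT F) -integral_indic//.
  have := integral_nnsfun mu measurableT (indic_nnsfun R mF).
  by rewrite patch_setT => <-.
apply: ge_ereal_sup => _ [phi phih <-].
have := integral_nnsfun mu measurableT phi; rewrite patch_setT => <-.
rewrite (@ge0_negligible_integral _ _ _ mu setT (~` F))//; last 3 first.
- exact: measurableC.
- by apply/measurable_EFinP; exact: measurable_funPT.
- by move=> x _; rewrite lee_fin.
have mTF : measurable (setT `\` ~` F) by apply: measurableD => //; exact: measurableC.
have TF : setT `\` ~` F = F by rewrite setTD setCK.
rewrite TF; apply: (@le_trans _ _ (\int[mu]_(x in F) cst C%:E x)%E).
  apply: ge0_le_integral => //.
  - by move=> x _; rewrite lee_fin.
  - by apply/measurable_EFinP/measurable_funTS; exact: measurable_funPT.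
  - move=> x Fx; apply: (le_trans (phih x)); by have /andP[] := hF x Fx.
by rewrite integral_cst// F1 mule1.
Qed.

End point_masses.

Lemma eq_indic (R : pzRingType) (T U : Type) (A : set T) (B : set U) a b :
  (A a <-> B b) -> \1_A a = \1_B b :> R.
Proof.
move=> AB; rewrite !indicE; congr (nat_of_bool _)%:R.
by apply/idP/idP => /set_mem/AB/mem_set.
Qed.

(** Finite sets are closed in such a space; this makes the periodic orbit closed, hence Borel. *)
Lemma skew_space_accessible (R : realType) (k : nat) (M : pseudoPMetricType R) :
  hausdorff_space M -> accessible_space (skew_space k M).
Proof.
move=> hM.
have aS : accessible_space (fullshift k).
  apply: hausdorff_accessible; apply: hausdorff_product => l.
  exact: discrete_hausdorff.
have aM := hausdorff_accessible hM.
move=> [s1 x1] [s2 x2] ne.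
have [es|/(aS s1 s2)[A [oA A1 A2]]] := eqVneq s1 s2.
  have /(aM x1 x2)[A [oA A1 A2]] : x1 != x2.
    by apply: contraNneq ne => ->; rewrite es.
  exists (snd @^-1` A); split.
  - by apply: open_comp => // p _; exact: cvg_snd.
  - by rewrite inE; exact: set_mem A1.
  - by rewrite inE; exact: set_mem A2.
exists (fst @^-1` A); split.
- by apply: open_comp => // p _; exact: cvg_fst.
- by rewrite inE; exact: set_mem A1.
- by rewrite inE; exact: set_mem A2.
Qed.

Lemma uniform_measure d (T : measurableType d) (R : realType) (N : nat)
    (z : 'I_N -> T) : (0 < N)%N ->
  exists m : probability T R, forall U,
    m U = (N%:R^-1 * \sum_j \1_U (z j))%:E.
Proof.
case: N z => // N z _.
pose s := behead [seq z j | j <- enum 'I_N.+1].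
have sE : z ord0 :: s = [seq z j | j <- enum 'I_N.+1] by rewrite /s enum_ordSl.
exists (point_mean (z ord0) s) => U.
apply: (etrans (@point_meanE _ _ R (z ord0) s U)).
rewrite sE big_map big_enum /=.
by congr (_%:R^-1 * _)%:E; rewrite size_behead size_map size_enum_ord.
Qed.

Lemma weighted_point_measure d (T : measurableType d) (R : realType) (c : R)
    (s : seq T) : 0 <= c ->
  exists nu : {measure set T -> \bar R}, forall U,
    nu U = (c * \sum_(y <- s) \1_U y)%:E.
Proof.
move=> c0; case: s => [|a s].
  by exists mzero => U; rewrite big_nil mulr0.
exists (mscale (NngNum c0) (point_sum a (a :: s))) => U.
have e : point_sum a (a :: s) U = (\sum_(y <- a :: s) \1_U y)%:E := point_sumE _ _ _.
by rewrite EFinM -e.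
Qed.

(** * The uniform measure on the periodic orbit and its lift *)

Section orbit_measure.
Context {R : realType} {n : nat} {M : pseudoPMetricType R}.
Variables (g : riemannian n M) (hM : compact_connected_riemannian g).
Variables (k : nat) (f : 'I_k.+1 -> M -> M) (ce : conformal_expanding g f).
Variables (lambda : probability (borel M) R) (S : inducing_scheme ce lambda).
Hypothesis hrho : rho_wf S.
Variable x : 'I_(nballs S) -> M.
Hypothesis xP : forall j,
  ((Mi S (cyc j))°) (x j) /\ hmap S (cyc j) (x j) = x (ordS j).
Local Notation N := (nballs S).
Local Notation z := (cycle_point x).
Hypothesis N0 : (0 < N)%N.
Variable m : probability (borel (skew_space k M)) R.
Hypothesis mE : forall U, m U = (N%:R^-1 * \sum_j \1_U (z j))%:E.

Let F : set (skew_space k M) := [set z j | j in setT].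

Lemma orbit_full_measure U : F `<=` U -> m U = 1%E.
Proof.
move=> FU; rewrite mE; congr EFin.
rewrite (eq_bigr (fun=> 1)) => [|j _].
  by rewrite sumr_const card_ord mulVf// pnatr_eq0 -lt0n.
by rewrite indicE mem_set//; apply: FU; exists j.
Qed.

Lemma orbit_null U : U `&` F = set0 -> m U = 0%E.
Proof.
move=> UF; rewrite mE big1 ?mulr0// => j _.
rewrite indicE memNset// => Uz; have : (U `&` F) (z j) by split => //; exists j.
by rewrite UF.
Qed.

Lemma closed_orbit : closed F.
Proof.
have [hH _ _] := hM.
apply: (accessible_finite_set_closed.1 (skew_space_accessible hH)).
exact: finite_image.
Qed.

Lemma orbit_sub_WW : F `<=` WW S.
Proof. by move=> _ [j _ <-]; exact: cycle_point_WW. Qed.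

Lemma orbit_supported : supported_in_WW S m.
Proof.
split; first by apply: orbit_null; apply/disjoints_subset/subsetCr; rewrite setCK; exact: orbit_sub_WW.
(* The complement of the orbit is open and null, so the topological support is contained in the
   orbit. *)
move=> y supp; apply: orbit_sub_WW; apply: contrapT => nF.
have := supp (~` F) (closed_openC closed_orbit) nF.
by rewrite orbit_null ?ltxx// setICl.
Qed.

Lemma orbit_sum_ordS (a : 'I_N -> R) : \sum_j a (ordS j) = \sum_j a j.
Proof.
by rewrite [RHS](reindex (@ordS N))//; apply: onW_bij; exact: ordS_bij.
Qed.

Lemma orbit_FApsi_preimage E j : \1_(FApsi_preimage S E) (z j) = \1_E (z (ordS j)) :> R.
Proof.
apply: eq_indic; rewrite /FApsi_preimage /= FApsi_cycle//; split; first by case.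
by split => //; exact: cycle_point_WW.
Qed.

Lemma orbit_invariant : FApsi_invariant S m.
Proof.
move=> E _; rewrite !mE; congr (_ * _)%:E.
by rewrite -(orbit_sum_ordS (fun j => \1_E (z j))); apply: eq_bigr => j _; exact: orbit_FApsi_preimage.
Qed.

(** Each point of the orbit has mass at least 1 / N. *)
Lemma orbit_null_notin U j : m U = 0%E -> ~ U (z j).
Proof.
rewrite mE => -[/eqP]; rewrite mulf_eq0 invr_eq0 pnatr_eq0 -leqn0 leqNgt N0 /=.
rewrite psumr_eq0// => /allP /(_ j); rewrite mem_index_enum => /(_ isT).
by rewrite /= indicE => /eqP + Uz; rewrite mem_set// => /eqP; rewrite oner_eq0.
Qed.

(** If [E] contained [z l] but not its successor, then [z l] would belong to a null set. So [E]
    contains the whole orbit as soon as it meets it, the cyclic successor being transitive. *)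
Lemma orbit_ergodic : FApsi_ergodic S m.
Proof.
move=> E _ h1 _.
have [[j Ej]|nE] := pselect (exists j, E (z j)); [right|left].
  apply: orbit_full_measure => _ [i _ <-].
  apply: (@ordS_ind _ (fun i => E (z i)) j Ej) => l El; apply: contrapT => nE.
  apply: (orbit_null_notin (j := l) h1); split => // -[_] /=.
  by rewrite FApsi_cycle.
by apply: orbit_null; rewrite -subset0 => y [Ey [j _ jE]]; apply: nE; exists j; rewrite jE.
Qed.

(** On the orbit, which has full measure, [psi] lies between 1 and the largest length of a word of
    the cycle. *)
Lemma orbit_Qm : (0 < Qm S m < +oo)%E.
Proof.
pose C : nat := \max_j size (wd S (cyc (i0 := S) j)).
have mF : measurable (F : set (borel (skew_space k M))).
  rewrite -[F]setCK; apply: measurableC.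
  by apply: sub_sigma_algebra; apply: closed_openC; exact: closed_orbit.
pose h := ((fun y : skew_space k M => ((psi S y)%:R : R)%:E) \_ (WW S)).
have h0 y : (0 <= h y)%E.
  by rewrite /h /patch; case: ifP => // _; rewrite lee_fin.
have hF y : F y -> (1 <= h y <= (C%:R : R)%:E)%E.
  move=> [j _ <-]; rewrite /h patchT; last by rewrite inE; exact: cycle_point_WW.
  rewrite psi_cycle// !lee_fin ler1n size_wd_gt0 ler_nat.
  exact: (leq_bigmax (F := fun j => size (wd S (cyc (i0 := S) j)))).
have F0 : m (~` F) = 0%E by apply: orbit_null; exact: setICl.
have /andP[Q1 QC] :=
  integral_bounds_full_set mF (orbit_full_measure (@subset_refl _ F)) F0 h0 hF.
rewrite /Qm integral_mkcond; apply/andP; split.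
  exact: lt_le_trans (lte01) Q1.
exact: le_lt_trans QC (ltry _).
Qed.

(** The point [z j] lies in the block [cyc j] and in no other, and its iterates before the return
    lie in [YY]. The factor [(i == cyc j)] allows several j to share a block. *)
Lemma orbit_block_mass E i : 
  (\sum_(l < size (wd S i)) m ((iter l (FA f)) @^-1` (E `&` YY S) `&` block S i) =
  (N%:R^-1 * \sum_j (i == cyc j)%:R *
     \sum_(l < size (wd S (cyc j))) \1_E (iter l (FA f) (z j)))%:E)%E.
Proof.
under eq_bigr do rewrite mE.
rewrite sumEFin -mulr_sumr exchange_big /=; congr (_ * _)%:E.
apply: eq_bigr => j _; have [->|ne] := eqVneq i (cyc j).
  rewrite mul1r; apply: eq_bigr => l _; apply: eq_indic.
  split=> /= [[[]]//|El]; split; last exact/cycle_point_block.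
  by split => //; exact: YY_cycle.
rewrite mul0r big1// => l _; rewrite indicE memNset// => -[_ /cycle_point_block].
by move=> /(_ hrho xP)/eqP; rewrite (negbTE ne).
Qed.

(** The tower over the periodic orbit: the [FA]-orbit segments between consecutive returns,
    repetitions being counted. *)
Let tower := flatten [seq traject (FA f) (z j) (size (wd S (cyc j))) | j <- enum 'I_N].

Lemma sum_tower (h : skew_space k M -> R) :
  \sum_(y <- tower) h y =
  \sum_j \sum_(l < size (wd S (cyc j))) h (iter l (FA f) (z j)).
Proof.
rewrite /tower big_flatten big_map big_enum /=; apply: eq_bigr => j _.
rewrite (big_nth (z j)) size_traject big_mkord; apply: eq_bigr => l _.
by rewrite nth_traject.
Qed.

Lemma lifted_orbit E : lifted S m (E `&` YY S) =
  ((fine (Qm S m))^-1 * N%:R^-1 * \sum_(y <- tower) \1_E y)%:E.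
Proof.
pose V j := \sum_(l < size (wd S (cyc j))) \1_E (iter l (FA f) (z j)) : R.
pose G i := (N%:R^-1 * \sum_j (i == cyc (i0 := S) j)%:R * V j)%:E.
have V0 j : 0 <= V j by apply: sumr_ge0 => l _; rewrite indicE.
have G0 i : (0 <= G i)%E.
  rewrite lee_fin mulr_ge0 ?invr_ge0//; apply: sumr_ge0 => j _.
  by rewrite mulr_ge0.
rewrite /lifted (eq_eseriesr (g := G)); last by move=> i _; exact: orbit_block_mass.
(* All [cyc j] are below K, so the series reduces to its first K terms. *)
pose K := (\max_j cyc (i0 := S) j)%N.+1.
have ltK (j : 'I_N) : (cyc j < K)%N.
  by rewrite ltnS; exact: (leq_bigmax (F := fun j => cyc (i0 := S) j)).
rewrite (nneseries_split 0 K)// add0n eseries0 => [|i Ki _]; last first.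
  rewrite /G big1 ?mulr0// => j _.
  by rewrite gtn_eqF ?mul0r// (leq_trans (ltK j)).
rewrite adde0 /G sumEFin -mulr_sumr exchange_big /= -EFinM mulrA.
congr (_ * _)%:E; rewrite sum_tower; apply: eq_bigr => j _.
rewrite -mulr_suml (bigD1_seq (cyc j)) ?iota_uniq ?mem_index_iota ?ltK//=.
by rewrite eqxx big1 ?addr0 ?mul1r// => i /negbTE ->.
Qed.

(** Passing to the preimage replaces each point of a segment by its successor, so the difference
    telescopes to the endpoints. The segment of j ends where that of [ordS j] begins, and the sum
    over the cycle cancels. *)
Lemma tower_FA_preimage E : E `<=` SigmaAM ce ->
  \sum_(y <- tower) \1_(FA_preimage ce E) y = \sum_(y <- tower) \1_E y :> R.
Proof.
move=> ES; rewrite !sum_tower; apply/eqP; rewrite -subr_eq0 -sumrB.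
pose a j l := \1_E (iter l (FA f) (z j)) : R.
rewrite (eq_bigr (fun j => a (ordS j) 0%N - a j 0%N)) => [|j _].
  by rewrite sumrB (orbit_sum_ordS (fun j => a j 0%N)) subrr.
rewrite -sumrB.
have -> : a (ordS j) 0%N = a j (size (wd S (cyc j))).
  by rewrite /a iter_FA_cycle.
rewrite -telescope_sumr// big_mkord; apply: eq_bigr => l _; congr (_ - _).
apply: eq_indic; split=> [[]//|El].
by split => //; exact: SigmaAM_cycle.
Qed.

Lemma orbit_lifted : lifted_is_invariant_measure S m.
Proof.
have /andP[Q0 _] := orbit_Qm.
have c0 : 0 <= (fine (Qm S m))^-1 * N%:R^-1.
  by rewrite mulr_ge0 ?invr_ge0// fine_ge0// ltW.
have [nu nuE] := @weighted_point_measure _ (borel (skew_space k M)) R _ tower c0.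
exists nu; split=> [E _|E _ ES]; first by rewrite nuE lifted_orbit.
by rewrite !nuE tower_FA_preimage.
Qed.

End orbit_measure.

Theorem theoremC (R : realType) (n : nat) (M : pseudoPMetricType R)
    (g : riemannian n M) (hM : compact_connected_riemannian g)
    (lambda : probability (borel M) R) (hlambda : normalized_volume g lambda)
    (alpha : R) (halpha : 0 < alpha <= 1)
    (k : nat) (f : 'I_k.+1 -> M -> M)
    (hf : C1_holder_semigroup g f alpha)
    (ce : conformal_expanding g f) (hmix : topologically_mixing ce)
    (S : inducing_scheme ce lambda) (hrho : rho_wf S) :
  exists m : probability (borel (skew_space k M)) R,
    [/\ supported_in_WW S m,
        FApsi_invariant S m,
        FApsi_ergodic S m,
        (0 < Qm S m < +oo)%E &
        lifted_is_invariant_measure S m].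
Proof.
have [_ hf' _] := hf.
have C1f i : C1_on g setT (f i) by have [[]] := hf' i.
have [x xP] := cyclic_orbit hM C1f S.
(* The distinguished point of [M] lies in one of the balls of the cover. *)
have N0 : (0 < nballs S)%N.
  by have [j _] := Bset_cover S point; exact: leq_ltn_trans (ltn_ord j).
have [m mE] := @uniform_measure _ (borel (skew_space k M)) R _ (cycle_point x) N0.
exists m; split.
- exact: (orbit_supported hM hrho xP mE).
- exact: (orbit_invariant hrho xP mE).
- exact: (orbit_ergodic hrho xP N0 mE).
- exact: (orbit_Qm hM hrho xP N0 mE).
- exact: (orbit_lifted hM hrho xP N0 mE).
Qed.
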